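(* (GBC) For all infinite cardinals $\lambda\le\kappa$, $$\langle\mathcal P(\kappa),[\kappa]^{<\lambda}\rangle\equiv_{L_b(S)}\langle\mathcal C(V),V\rangle.$$ In particular, $\langle\mathcal P(2^\lambda),[2^\lambda]^{\le\lambda}\rangle\equiv_{L_b(S)}\langle\mathcal C(V),V\rangle$.
   Context: Work in a model of GBC (Gödel–Bernays class theory with choice); $\mathcal C(V)$ is the Boolean algebra of all classes (subclasses of the universe $V$), and the predicate $V$ on it picks out those classes that are sets. $[\kappa]^{<\lambda}=\{x\subseteq\kappa:|x|<\lambda\}$, $[A]^{\le\lambda}=\{x\subseteq A:|x|\le\lambda\}$. $L_b(S)$ is the first-order language with a binary relation $\sqsubseteq$ (interpreted as inclusion) and a unary predicate $S$ (interpreted as membership in the given ideal: $[\kappa]^{<\lambda}$, respectively the class of sets). $\equiv_{L_b(S)}$ denotes elementary equivalence in this language. *)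

(* Defs.v *)
(* A model of GBC is given abstractly as a type M of
   objects (classes) with a membership relation satisfying the GBC axioms;
   sets are the classes that are members of something.  All set-theoretic
   notions (ordinals, cardinals, cardinality comparisons, P(kappa)) are
   computed INSIDE the model. *)
From Stdlib Require Import List PeanoNat.
Import ListNotations.

Definition scons {A : Type} (a : A) (e : nat -> A) (n : nat) : A :=
  match n with 0 => a | S k => e k end.

(* First-order formulas of the language {∈, =} with SET quantifiers only
   (used for the predicative class-comprehension schema of GB). *)
Inductive eform : Type :=
| EMem (i j : nat) | EEq (i j : nat) | ENot (p : eform)
| EAnd (p q : eform) | EEx (p : eform).

Inductive bform : Type :=
| BSub (i j : nat) | BEq (i j : nat) | BS (i : nat) | BNot (p : bform)
| BAnd (p q : bform) | BEx (p : bform).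

Fixpoint bclosed (n : nat) (p : bform) : Prop :=
  match p with
  | BSub i j | BEq i j => i < n /\ j < n
  | BS i => i < n
  | BNot q => bclosed n q
  | BAnd q r => bclosed n q /\ bclosed n r
  | BEx q => bclosed (S n) q
  end.

Fixpoint sat {A : Type} (le : A -> A -> Prop) (Sp : A -> Prop)
  (env : list A) (p : bform) : Prop :=
  match p with
  | BSub i j => match nth_error env i, nth_error env j with
                | Some a, Some b => le a b | _, _ => False end
  | BEq i j => match nth_error env i, nth_error env j with
               | Some a, Some b => a = b | _, _ => False end
  | BS i => match nth_error env i with Some a => Sp a | None => False end
  | BNot q => ~ sat le Sp env q
  | BAnd q r => sat le Sp env q /\ sat le Sp env r
  | BEx q => exists a : A, sat le Sp (a :: env) q
  end.

Definition elem_equiv {A B : Type} (leA : A -> A -> Prop) (SA : A -> Prop)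
  (leB : B -> B -> Prop) (SB : B -> Prop) : Prop :=
  forall p : bform, bclosed 0 p -> (sat leA SA [] p <-> sat leB SB [] p).

Section GBCModel.
Variable M : Type.
Variable mem : M -> M -> Prop.

Definition isSet (x : M) : Prop := exists y, mem x y.
Definition subclass (x y : M) : Prop := forall z, mem z x -> mem z y.
Definition is_pair (p a b : M) : Prop := forall z, mem z p <-> z = a \/ z = b.
Definition is_opair (p x y : M) : Prop :=
  exists s t, is_pair s x x /\ is_pair t x y /\ is_pair p s t.
Definition pair_in (x y F : M) : Prop := exists p, is_opair p x y /\ mem p F.
Definition functional (F : M) : Prop :=
  forall x y y', pair_in x y F -> pair_in x y' F -> y = y'.

Fixpoint eval (e : nat -> M) (p : eform) : Prop :=
  match p with
  | EMem i j => mem (e i) (e j)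
  | EEq i j => e i = e j
  | ENot q => ~ eval e q
  | EAnd q r => eval e q /\ eval e r
  | EEx q => exists x, isSet x /\ eval (scons x e) q
  end.

Record GBC : Prop := {
  ax_ext : forall x y, (forall z, mem z x <-> mem z y) -> x = y;
  ax_pair : forall a b, isSet a -> isSet b -> exists p, isSet p /\ is_pair p a b;
  ax_union : forall a, isSet a -> exists u, isSet u /\
      forall z, mem z u <-> exists y, mem z y /\ mem y a;
  ax_power : forall a, isSet a -> exists p, isSet p /\
      forall z, mem z p <-> isSet z /\ subclass z a;
  ax_sep : forall a C, isSet a -> exists b, isSet b /\
      forall z, mem z b <-> mem z a /\ mem z C;
  ax_inf : exists w, isSet w /\ (exists e, mem e w /\ forall z, ~ mem z e) /\
      forall y, mem y w -> exists s, mem s w /\ forall z, mem z s <-> mem z y \/ z = y;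
  ax_repl : forall F a, functional F -> isSet a -> exists b, isSet b /\
      forall y, mem y b <-> exists x, mem x a /\ pair_in x y F;
  ax_found : forall C, (exists z, mem z C) ->
      exists z, mem z C /\ forall w, mem w z -> ~ mem w C;
  ax_compr : forall (phi : eform) (e : nat -> M), exists C,
      forall x, isSet x -> (mem x C <-> eval (scons x e) phi);
  ax_gchoice : exists G, functional G /\
      forall x, isSet x -> (exists z, mem z x) -> exists y, mem y x /\ pair_in x y G
}.

Definition is_fun (f a b : M) : Prop :=
  isSet f /\
  (forall p, mem p f -> exists x y, mem x a /\ mem y b /\ is_opair p x y) /\
  (forall x, mem x a -> exists y, pair_in x y f) /\ functional f.
Definition injective_set (f : M) : Prop :=
  forall x x' y, pair_in x y f -> pair_in x' y f -> x = x'.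
Definition surjective_onto (f b : M) : Prop :=
  forall y, mem y b -> exists x, pair_in x y f.

Definition card_le (a b : M) : Prop := exists f, is_fun f a b /\ injective_set f.
Definition card_eq (a b : M) : Prop :=
  exists f, is_fun f a b /\ injective_set f /\ surjective_onto f b.
Definition card_lt (a b : M) : Prop := card_le a b /\ ~ card_le b a.

(* von Neumann ordinals (well-foundedness comes from Foundation). *)
Definition ordinal (a : M) : Prop :=
  isSet a /\ (forall x y, mem x a -> mem y x -> mem y a) /\
  (forall x y, mem x a -> mem y a -> mem x y \/ x = y \/ mem y x).
Definition is_empty (k : M) : Prop := forall z, ~ mem z k.
Definition is_succ (k : M) : Prop := exists m, forall z, mem z k <-> mem z m \/ z = m.
Definition natural (n : M) : Prop :=
  ordinal n /\ (is_empty n \/ is_succ n) /\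
  (forall k, mem k n -> is_empty k \/ is_succ k).
Definition cardinal (k : M) : Prop :=
  ordinal k /\ forall b, mem b k -> ~ card_eq b k.
Definition infinite_cardinal (k : M) : Prop := cardinal k /\ ~ natural k.

Definition PK (kappa : M) : Type := {x : M | isSet x /\ subclass x kappa}.
Definition PK_sub (kappa : M) (x y : PK kappa) : Prop :=
  subclass (proj1_sig x) (proj1_sig y).
Definition small_lt (kappa lambda : M) (x : PK kappa) : Prop :=
  card_lt (proj1_sig x) lambda.
Definition small_le (kappa lambda : M) (x : PK kappa) : Prop :=
  card_le (proj1_sig x) lambda.

Definition is_two_pow (lambda mu : M) : Prop :=
  cardinal mu /\ exists P, isSet P /\
    (forall z, mem z P <-> isSet z /\ subclass z lambda) /\ card_eq mu P.

End GBCModel.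

(* Main.v *)
(* An element of either structure has, for the purposes of an Ehrenfeucht-Fraisse
   game with k rounds to go, only two features: the number of its points, truncated
   at 2^k, and whether it lies in the ideal.  Duplicator maintains that
   corresponding cells of the partitions generated so far agree in these features.
   The only case that needs set theory is Spoiler cutting a cell outside the ideal
   into two pieces outside the ideal: each structure must be able to do this.

   For a class A linearly ordered by membership, cut A into its even and its odd
   elements; each odd element is the successor in A of an even one, and at most one
   even element has no successor, so if one half were small then so would be the
   other, hence A.  Subsets of kappa are of this form.  An arbitrary proper class is
   cut through the ranks of its elements.  That [kappa]^{<lambda} and
   [mu]^{<=lambda} are closed under unions comes from ordinal doubling, which maps a
   limit ordinal into itself. *)
From Stdlib Require Import List PeanoNat Lia Classical ProofIrrelevance.
Require Import Defs.
Import ListNotations.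

(** * Back-and-forth between atomic Boolean algebras with an ideal *)

(** The threshold doubles with the number of rounds because one move cuts a cell in two: a piece
    with fewer than 2^k points is copied point by point, and the rest still has to agree up to 2^k.
    Parity is a good cut because it works without knowing the size of the chain: the successor map
    is injective, so an ideal closed under injective images and one-point extensions cannot contain
    just one of the halves. The obstacle on the set-theoretic side is that class comprehension is
    given only for formulas whose quantifiers range over sets. Every class, minimal counterexample
    and recursion must therefore come with a proof of predicative definability; [definable] and the
    tactic [dfn] produce these proofs from the shape of a predicate. A single recursion theorem,
    along any class linearly ordered by membership, serves parity, transitive collapse and doubling,
    whereas the cumulative hierarchy is obtained without recursion, each level being certified by a
    set. *)

Definition at_least {X : Type} (n : nat) (P : X -> Prop) : Prop :=
  exists l, NoDup l /\ length l = n /\ forall x, In x l -> P x.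

Definition minus {X : Type} (P Q : X -> Prop) : X -> Prop := fun x => P x /\ ~ Q x.

Lemma at_least_mono {X : Type} n m (P Q : X -> Prop) :
  m <= n -> (forall x, P x -> Q x) -> at_least n P -> at_least m Q.
Proof.
  intros Hm HPQ (l & Hnd & Hlen & Hl).
  exists (firstn m l). split; [|split].
  - rewrite <- (firstn_skipn m l) in Hnd. eapply NoDup_app_remove_r; eauto.
  - rewrite length_firstn. lia.
  - intros x Hx. apply HPQ, Hl. rewrite <- (firstn_skipn m l). apply in_or_app; auto.
Qed.

Lemma at_least_0 {X : Type} (P : X -> Prop) : at_least 0 P.
Proof. exists []. repeat split; [constructor | contradiction]. Qed.

Lemma at_least_1 {X : Type} (P : X -> Prop) : at_least 1 P <-> exists x, P x.
Proof.
  split.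
  - intros ([|x l] & _ & Hlen & Hl); [discriminate|]. exists x; apply Hl; now left.
  - intros (x & Hx). exists [x]. split; [|split; auto].
    + repeat constructor; auto.
    + intros y [<-|[]]; auto.
Qed.

Lemma at_least_remove {X : Type} n (P : X -> Prop) (x : X) :
  P x -> (at_least (S n) P <-> at_least n (minus P (eq x))).
Proof.
  intros Hx. split.
  - intros (l & Hnd & Hlen & Hl).
    destruct (classic (In x l)) as [Hin|Hin].
    + destruct (in_split _ _ Hin) as (l1 & l2 & ->).
      apply NoDup_remove in Hnd as [Hnd Hni].
      exists (l1 ++ l2). split; [auto|split].
      * rewrite length_app in *. simpl in Hlen. lia.
      * intros y Hy. split.
        -- apply Hl. apply in_app_or in Hy. apply in_or_app. simpl. tauto.
        -- intros <-; contradiction.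
    + destruct l as [|y l]; [discriminate|]. inversion Hnd; subst.
      exists l. split; [auto|split; [now injection Hlen|]].
      intros z Hz. split; [apply Hl; now right|]. intros <-; apply Hin; now right.
  - intros (l & Hnd & Hlen & Hl). exists (x :: l). split; [|split].
    + constructor; auto. intros Hin. now apply Hl in Hin as [_ []].
    + simpl; congruence.
    + intros y [<-|Hy]; [auto|]. now apply Hl.
Qed.

Lemma at_least_minus_list {X : Type} (l : list X) : forall m (P : X -> Prop),
  NoDup l -> (forall x, In x l -> P x) ->
  (at_least (length l + m) P <-> at_least m (minus P (fun x => In x l))).
Proof.
  induction l as [|x l IH]; intros m P Hnd Hl; simpl.
  - split; apply at_least_mono; auto; unfold minus; simpl; tauto.
  - inversion Hnd; subst. rewrite (at_least_remove _ P x) by (apply Hl; now left).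
    rewrite IH; auto.
    + split; apply at_least_mono; auto; unfold minus; simpl; tauto.
    + intros y Hy. split; [apply Hl; now right|]. intros <-; contradiction.
Qed.

Lemma exact_count {X : Type} N (P : X -> Prop) : ~ at_least N P ->
  exists l, NoDup l /\ length l < N /\ forall x, P x <-> In x l.
Proof.
  revert P. induction N as [|N IH]; intros P HN.
  - destruct HN. apply at_least_0.
  - destruct (classic (exists x, P x)) as [(x & Hx)|Hno].
    + rewrite (at_least_remove _ _ x Hx) in HN.
      destruct (IH _ HN) as (l & Hnd & Hlen & Hl).
      exists (x :: l). split; [|split; [simpl; lia|]].
      * constructor; auto. intros Hin. now apply Hl in Hin as [_ []].
      * intros y. simpl. rewrite <- Hl. unfold minus. split.
        -- intros Hy. destruct (classic (x = y)); tauto.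
        -- intros [<-|[]]; auto.
    + exists []. split; [constructor|split; [simpl; lia|]].
      intros x. split; [|contradiction]. intros Hx. apply Hno. eauto.
Qed.

(* [R] plays the role of the Boolean algebra, presented as a field of subsets
   of [X], and [S] that of the ideal. *)
Record ideal_algebra {X : Type} (R S : (X -> Prop) -> Prop) : Prop := {
  ia_ext : forall P Q, (forall x, P x <-> Q x) -> R P -> R Q;
  ia_minus : forall P Q, R P -> R Q -> R (minus P Q);
  ia_union : forall P Q, R P -> R Q -> R (fun x => P x \/ Q x);
  ia_ideal : forall P, S P -> R P;
  ia_down : forall P Q, R P -> (forall x, P x -> Q x) -> S Q -> S P;
  ia_join : forall P Q, S P -> S Q -> S (fun x => P x \/ Q x);
  ia_empty : S (fun _ => False);
  ia_single : forall P x, R P -> P x -> S (eq x);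
  ia_top : exists T, R T /\ ~ S T /\ forall P, R P -> forall x, P x -> T x;
  ia_split : forall P, R P -> ~ S P ->
    exists Q, R Q /\ (forall x, Q x -> P x) /\ ~ S Q /\ ~ S (minus P Q)
}.

Section OneAlgebra.
Context {X : Type} {R S : (X -> Prop) -> Prop} (H : ideal_algebra R S).

Lemma S_ext P Q : (forall x, P x <-> Q x) -> S P -> S Q.
Proof.
  intros HPQ HP. apply (ia_down _ _ H Q P).
  - eapply ia_ext; eauto. eapply ia_ideal; eauto.
  - apply HPQ.
  - auto.
Qed.

Lemma R_inter P Q : R P -> R Q -> R (fun x => P x /\ Q x).
Proof.
  intros HP HQ. apply (ia_ext _ _ H (minus P (minus P Q))).
  - intros x. unfold minus. destruct (classic (Q x)); tauto.
  - repeat apply (ia_minus _ _ H); auto.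
Qed.

Lemma S_list P l : R P -> (forall x, In x l -> P x) -> S (fun x => In x l).
Proof.
  intros HP. induction l as [|x l IH]; intros Hl.
  - apply (ia_empty _ _ H).
  - apply (ia_join _ _ H (eq x)); [eapply ia_single; eauto; apply Hl; now left|].
    apply IH. intros; apply Hl; now right.
Qed.

(** Singletons lie in the ideal and the ideal has joins, so every finite member of [R] is small; a
    member outside the ideal is infinite and exceeds every threshold. *)
Lemma not_S_at_least P n : R P -> ~ S P -> at_least n P.
Proof.
  intros HP HS. apply NNPP; intros Hn.
  destruct (exact_count _ _ Hn) as (l & _ & _ & Hl).
  apply HS. apply (S_ext (fun x => In x l)); [intros; symmetry; apply Hl|].
  apply (S_list P); auto. apply Hl.
Qed.

Lemma S_minus P Q : R P -> S Q -> (forall x, Q x -> P x) -> (S (minus P Q) <-> S P).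
Proof.
  intros HP HQ HQP. split; intros HS.
  - apply (S_ext (fun x => Q x \/ minus P Q x)).
    + intros x. unfold minus. split; [intros [?|[? _]]; auto|].
      destruct (classic (Q x)); tauto.
    + apply (ia_join _ _ H); auto.
  - apply (ia_down _ _ H _ P); auto.
    + apply (ia_minus _ _ H); auto. eapply ia_ideal; eauto.
    + now intros x [].
Qed.

(** The unit is described intrinsically, so that cells do not depend on a chosen witness of
    [ia_top]. *)
Definition top : X -> Prop := fun x => exists P, R P /\ P x.

Lemma R_top : R top.
Proof.
  destruct (ia_top _ _ H) as (T & HT & _ & Hall).
  apply (ia_ext _ _ H T); auto. intros x; split.
  - intros; exists T; auto.
  - intros (P & HP & Hx). eauto.
Qed.

Lemma not_S_top : ~ S top.
Proof.
  destruct (ia_top _ _ H) as (T & HT & HnT & Hall). intros HS. apply HnT.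
  apply (ia_down _ _ H _ top); auto. intros x Hx. exists T; auto.
Qed.

End OneAlgebra.

(** Agreement for every [n] up to 2^k expresses that the two counts, truncated at 2^k, coincide,
    without assigning a number to a possibly infinite cell. *)
Definition similar {X Y : Type} (S1 : (X -> Prop) -> Prop) (S2 : (Y -> Prop) -> Prop)
  (k : nat) (P : X -> Prop) (Q : Y -> Prop) : Prop :=
  (forall n, n <= 2 ^ k -> (at_least n P <-> at_least n Q)) /\ (S1 P <-> S2 Q).

Section TwoAlgebras.
Context {X Y : Type} {R1 S1 : (X -> Prop) -> Prop} {R2 S2 : (Y -> Prop) -> Prop}.
Hypothesis (H1 : ideal_algebra R1 S1) (H2 : ideal_algebra R2 S2).

Lemma similar_large k P Q : at_least (2 ^ k) P -> at_least (2 ^ k) Q ->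
  (S1 P <-> S2 Q) -> similar S1 S2 k P Q.
Proof.
  intros HP HQ HS. split; auto. intros n Hn; split; intros _.
  - now apply (at_least_mono (2 ^ k) n Q Q).
  - now apply (at_least_mono (2 ^ k) n P P).
Qed.

Lemma similar_extP k P P' Q : (forall x, P x <-> P' x) ->
  similar S1 S2 k P Q -> R1 P -> similar S1 S2 k P' Q.
Proof.
  intros HP [Hn HS] HR. split.
  - intros n Hle. rewrite <- (Hn n Hle). split; apply at_least_mono; auto; apply HP.
  - rewrite <- HS. split; apply (S_ext H1); intros x; rewrite HP; tauto.
Qed.

Lemma similar_extQ k P Q Q' : (forall x, Q x <-> Q' x) ->
  similar S1 S2 k P Q -> R2 Q -> similar S1 S2 k P Q'.
Proof.
  intros HP [Hn HS] HR. split.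
  - intros n Hle. rewrite (Hn n Hle). split; apply at_least_mono; auto; apply HP.
  - rewrite HS. split; apply (S_ext H2); intros x; rewrite HP; tauto.
Qed.

Definition answers k (P A : X -> Prop) (Q B : Y -> Prop) : Prop :=
  R2 B /\ (forall y, B y -> Q y) /\
  similar S1 S2 k A B /\ similar S1 S2 k (minus P A) (minus Q B).

(** Duplicator copies the points of [A] one by one. Both remainders then lose the same number of
    points, less than 2^k, so their agreement up to 2^k follows from that of [P] and [Q] up to
    2^(k+1). *)
Lemma answer_few k P A Q : R1 P -> R2 Q -> R1 A -> (forall x, A x -> P x) ->
  similar S1 S2 (S k) P Q -> ~ at_least (2 ^ k) A ->
  exists B, answers k P A Q B.
Proof.
  intros HP HQ HA HAP [Hn HS] Hfew.
  destruct (exact_count _ _ Hfew) as (l & Hnd & Hlen & Hl).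
  assert (Hpow : 2 ^ S k = 2 ^ k + 2 ^ k) by (simpl; lia).
  assert (HlP : forall x, In x l -> P x) by (intros; apply HAP, Hl; auto).
  assert (HQl : at_least (length l) Q).
  { apply Hn; [lia|]. exists l; auto. }
  destruct HQl as (l' & Hnd' & Hlen' & Hl').
  assert (HSA : S1 A).
  { apply (S_ext H1 (fun x => In x l)); [firstorder|]. apply (S_list H1 P); auto. }
  assert (HSB : S2 (fun x => In x l')) by (apply (S_list H2 Q); auto).
  exists (fun x => In x l'). split; [eapply ia_ideal; eauto|split; [auto|split; split]].
  - intros n Hle.
    assert (HAn : at_least n A <-> n <= length l).
    { split.
      - intros (m & Hm & <- & Hin). apply NoDup_incl_length; auto.
        intros x Hx. apply Hl; auto.
      - intros Hle'. apply (at_least_mono (length l) n (fun x => In x l)); auto.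
        + apply Hl.
        + exists l; auto. }
    rewrite HAn. rewrite <- Hlen'. split.
    + intros Hle'. apply (at_least_mono (length l') n (fun x => In x l')); auto.
      exists l'; auto.
    + intros (m & Hm & <- & Hin). apply NoDup_incl_length; auto.
  - tauto.
  - intros n Hle. rewrite <- at_least_minus_list by auto.
    rewrite Hlen', <- Hn by lia. rewrite at_least_minus_list by auto.
    split; apply at_least_mono; auto; unfold minus; intros x; rewrite Hl; tauto.
  - rewrite (S_minus H1), (S_minus H2); auto.
Qed.

Lemma minus_minus (P A : X -> Prop) : (forall x, A x -> P x) ->
  forall x, minus P (minus P A) x <-> A x.
Proof.
  intros HAP x. unfold minus. destruct (classic (A x)); firstorder.
Qed.

(** Exchanges the two pieces of a cut, so that each case below has to be treated only when the
    distinguished piece is [A] itself. *)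
Lemma answers_compl k P A Q B : R1 P -> R2 Q -> R1 A -> (forall x, A x -> P x) ->
  answers k P (minus P A) Q B -> exists B', answers k P A Q B'.
Proof.
  intros HP HQ HA HAP (HB & HBQ & Hs1 & Hs2).
  exists (minus Q B). split; [eapply ia_minus; eauto|split; [now intros y []|split]].
  - eapply similar_extP; [|apply Hs2|]; [now apply minus_minus|].
    repeat (eapply ia_minus; eauto).
  - eapply similar_extQ; [|apply Hs1|auto].
    intros y. specialize (HBQ y). unfold minus. destruct (classic (B y)); tauto.
Qed.

(** The answer consists of exactly 2^k points of [Q], whatever the size of [A]: it is finite, hence
    in the ideal, it already reaches the threshold, and at least 2^k of the 2^(k+1) points of [Q]
    remain. *)
Lemma answer_small k P A Q : R1 P -> R2 Q -> R1 A -> (forall x, A x -> P x) ->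
  similar S1 S2 (S k) P Q -> at_least (2 ^ k) A -> at_least (2 ^ k) (minus P A) ->
  S1 A -> at_least (2 ^ S k) Q -> exists B, answers k P A Q B.
Proof.
  intros HP HQ HA HAP [Hn HS] HA1 HA2 HSA HQ2.
  assert (Hpow : 2 ^ S k = 2 ^ k + 2 ^ k) by (simpl; lia).
  destruct (at_least_mono (2 ^ S k) (2 ^ k) Q Q) as (l & Hnd & Hlen & Hl);
    [lia|auto|auto|].
  assert (HSB : S2 (fun x => In x l)) by (apply (S_list H2 Q); auto).
  exists (fun x => In x l). split; [eapply ia_ideal; eauto|split; [auto|split]].
  - apply similar_large; [auto|exists l; auto|tauto].
  - apply similar_large; [auto| |].
    + apply at_least_minus_list; auto. now rewrite Hlen, <- Hpow.
    + rewrite (S_minus H1), (S_minus H2); auto.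
Qed.

Lemma answer k P A Q : R1 P -> R2 Q -> R1 A -> (forall x, A x -> P x) ->
  similar S1 S2 (S k) P Q -> exists B, answers k P A Q B.
Proof.
  intros HP HQ HA HAP Hsim.
  assert (HPA : R1 (minus P A)) by (eapply ia_minus; eauto).
  assert (HPA' : forall x, minus P A x -> P x) by now intros x [].
  destruct (classic (at_least (2 ^ k) A)) as [HA1|HA1];
    [|now apply answer_few].
  destruct (classic (at_least (2 ^ k) (minus P A))) as [HA2|HA2].
  2:{ destruct (answer_few k P (minus P A) Q) as (B & HB); auto.
      eapply answers_compl; eauto. }
  assert (Hbig : at_least (2 ^ S k) Q).
  { apply Hsim; auto. destruct HA1 as (l1 & Hnd1 & Hlen1 & Hl1).
    replace (2 ^ S k) with (length l1 + 2 ^ k) by (simpl; lia).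
    apply at_least_minus_list; auto.
    destruct HA2 as (l2 & Hnd2 & Hlen2 & Hl2). exists l2.
    split; [auto|split; [auto|]]. intros x Hx. destruct (Hl2 x Hx). split; auto. }
  destruct (classic (S1 A)) as [HSA|HSA]; [now apply answer_small|].
  destruct (classic (S1 (minus P A))) as [HSA2|HSA2].
  { destruct (answer_small k P (minus P A) Q) as (B & HB); auto.
    - apply (at_least_mono (2 ^ k) (2 ^ k) A); auto. intros x Hx.
      apply minus_minus; auto.
    - eapply answers_compl; eauto. }
  assert (HSQ : ~ S2 Q).
  { intros HSQ. apply HSA. apply (ia_down _ _ H1 A P); auto. now apply Hsim. }
  (* Both pieces are outside the ideal here. Once [Q] is split in the same way the counts take care
     of themselves, because sets outside the ideal are infinite. *)
  destruct (ia_split _ _ H2 Q HQ HSQ) as (B & HB & HBQ & HSB1 & HSB2).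
  exists B. split; [auto|split; [auto|split]]; apply similar_large; auto; try tauto.
  - now apply (not_S_at_least H2).
  - apply (not_S_at_least H2); auto. eapply ia_minus; eauto.
Qed.

End TwoAlgebras.

(* [cell T env s] is the set of points of [T] that lie in the [i]-th element of
   [env] exactly when the [i]-th entry of [s] is [true]. *)
Fixpoint cell {X : Type} (T : X -> Prop) (env : list (X -> Prop)) (s : list bool)
  : X -> Prop :=
  match env, s with
  | [], [] => T
  | P :: env', b :: s' => fun x => cell T env' s' x /\ (P x <-> b = true)
  | _, _ => fun _ => False
  end.

(** An explicit finite list of all cells is needed because Duplicator's answers in the single cells
    are glued by finitely many binary unions. *)
Fixpoint signs (n : nat) : list (list bool) :=
  match n with
  | 0 => [[]]
  | S n => map (cons true) (signs n) ++ map (cons false) (signs n)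
  end.

Lemma in_signs n s : In s (signs n) <-> length s = n.
Proof.
  revert s. induction n as [|n IH]; intros s; simpl.
  - destruct s; simpl; intuition; discriminate.
  - rewrite in_app_iff, !in_map_iff. split.
    + intros [(t & <- & Ht)|(t & <- & Ht)]; apply IH in Ht; simpl; auto.
    + destruct s as [|[] s]; simpl; [discriminate| |]; intros [= Hs];
        apply IH in Hs; [left|right]; eauto.
Qed.

Lemma nodup_signs n : NoDup (signs n).
Proof.
  assert (Hmap : forall b (l : list (list bool)), NoDup l -> NoDup (map (cons b) l)).
  { intros b l Hl. induction Hl; simpl; constructor; auto.
    rewrite in_map_iff. intros (y & [= ->] & Hy). contradiction. }
  induction n as [|n IH]; simpl.
  - repeat constructor; auto.
  - apply NoDup_app; auto. intros s. rewrite !in_map_iff.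
    intros (t & <- & _) (u & [=] & _).
Qed.

Lemma cell_length {X : Type} (T : X -> Prop) env s x :
  cell T env s x -> length s = length env.
Proof.
  revert s. induction env as [|P env IH]; intros [|b s]; simpl; try tauto.
  intros [Hc _]. f_equal. now apply IH.
Qed.

Lemma cell_disjoint {X : Type} (T : X -> Prop) env s t x :
  cell T env s x -> cell T env t x -> s = t.
Proof.
  revert s t. induction env as [|P env IH]; intros [|b s] [|c t]; simpl; try tauto.
  intros [Hs Hb] [Ht Hc]. f_equal; [|now apply IH].
  destruct b, c; auto; intuition discriminate.
Qed.

Lemma cell_nth {X : Type} (T : X -> Prop) env s i P x :
  cell T env s x -> nth_error env i = Some P -> (P x <-> nth_error s i = Some true).
Proof.
  revert s i. induction env as [|Q env IH]; intros [|b s] i; simpl; try tauto.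
  - intros _. destruct i; discriminate.
  - intros [Hc Hb] Hi. destruct i as [|i]; simpl in *.
    + injection Hi as ->. rewrite Hb. intuition congruence.
    + now apply IH.
Qed.

Lemma cell_cover {X : Type} (T : X -> Prop) env x :
  T x -> exists s, cell T env s x.
Proof.
  intros Hx. induction env as [|P env (s & Hs)].
  - now exists [].
  - destruct (classic (P x)) as [HP|HP]; [exists (true :: s)|exists (false :: s)];
      simpl; intuition discriminate.
Qed.

Lemma R_cell {X : Type} {R S : (X -> Prop) -> Prop} (H : ideal_algebra R S) env :
  Forall R env -> forall s, R (cell (top (R := R)) env s).
Proof.
  induction 1 as [|P env HP Henv IH]; intros [|b s]; simpl;
    try (eapply ia_ideal, ia_empty; eassumption).
  - apply (R_top H).
  - destruct b.
    + apply (ia_ext _ _ H (fun x => cell (top (R := R)) env s x /\ P x)); [intuition|].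
      now apply (R_inter H).
    + apply (ia_ext _ _ H (minus (cell (top (R := R)) env s) P)).
      * intros x. unfold minus. intuition discriminate.
      * eapply ia_minus; eauto.
Qed.

(** There are finitely many cells and the ideal has joins, so smallness can be tested cell by cell;
    the induction merges the two halves into which [Q] cuts each coarser cell. *)
Lemma S_cells {X : Type} {R S : (X -> Prop) -> Prop} (H : ideal_algebra R S) env :
  Forall R env -> forall P, R P ->
  (forall s, S (fun x => P x /\ cell (top (R := R)) env s x)) -> S P.
Proof.
  induction 1 as [|Q env HQ Henv IH]; intros P HP Hs.
  - apply (S_ext H _ _) with (2 := Hs []). intros x; simpl; split; [tauto|].
    intros Hx; split; auto. exists P; auto.
  - apply IH; auto. intros s.
    eapply (S_ext H _ _); [|apply (ia_join _ _ H _ _ (Hs (true :: s)) (Hs (false :: s)))].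
    intros x; simpl. destruct (classic (Q x)); intuition discriminate.
Qed.

(** * The game played on finite partitions *)

Section Game.
Context {X Y : Type} {R1 S1 : (X -> Prop) -> Prop} {R2 S2 : (Y -> Prop) -> Prop}.
Hypothesis (H1 : ideal_algebra R1 S1) (H2 : ideal_algebra R2 S2).

Definition position k (env1 : list (X -> Prop)) (env2 : list (Y -> Prop)) : Prop :=
  Forall R1 env1 /\ Forall R2 env2 /\ length env1 = length env2 /\
  forall s, similar S1 S2 k (cell (top (R := R1)) env1 s) (cell (top (R := R2)) env2 s).

Lemma similar_empty k : similar S1 S2 k (fun _ => False) (fun _ => False).
Proof.
  split.
  - intros [|n] _; split; intros HF; try apply at_least_0;
      destruct HF as ([|x l] & _ & Hl & Hin); try discriminate;
      destruct (Hin x); now left.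
  - split; intros _; [apply (ia_empty _ _ H2)|apply (ia_empty _ _ H1)].
Qed.

(** The only nonempty cell is the unit, which is outside the ideal and therefore infinite on both
    sides; hence the empty position is good for every number of rounds. *)
Lemma position_nil k : position k [] [].
Proof.
  split; [constructor|split; [constructor|split; [auto|]]].
  intros [|b s]; simpl; [|apply similar_empty]. split.
  - intros n _. split; intros _.
    + apply (not_S_at_least H2); [apply (R_top H2)|apply (not_S_top H2)].
    + apply (not_S_at_least H1); [apply (R_top H1)|apply (not_S_top H1)].
  - split; intros Hs; exfalso; [now apply (not_S_top H1)|now apply (not_S_top H2)].
Qed.

Lemma position_step k env1 env2 A : position (S k) env1 env2 -> R1 A ->
  exists B, R2 B /\ position k (A :: env1) (B :: env2).
Proof.
  intros (HR1 & HR2 & Hlen & Hsim) HA.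
  set (c1 := cell (top (R := R1)) env1) in *.
  set (c2 := cell (top (R := R2)) env2) in *.
  (* Answers are collected along a list of sign vectors. [B] is kept inside the cells already
     listed, so that by disjointness neither the old answers nor the new one disturb each other. *)
  assert (HL : forall L, NoDup L -> exists B, R2 B /\
    (forall y, B y -> exists s, In s L /\ c2 s y) /\
    forall s, In s L ->
      similar S1 S2 k (fun x => c1 s x /\ A x) (fun y => c2 s y /\ B y) /\
      similar S1 S2 k (minus (c1 s) A) (minus (c2 s) B)).
  { induction L as [|s L IH]; intros HndL.
    - exists (fun _ => False). split; [eapply ia_ideal, ia_empty; eauto|].
      split; simpl; tauto.
    - inversion HndL as [|? ? HsL HndL']; subst.
      destruct (IH HndL') as (B & HB & HBL & HBs).
      destruct (answer H1 H2 k (c1 s) (fun x => c1 s x /\ A x) (c2 s))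
        as (C & HC & HCs & Hs1 & Hs2); auto.
      { apply R_cell with (1 := H1); auto. }
      { apply R_cell with (1 := H2); auto. }
      { apply (R_inter H1); auto. apply R_cell with (1 := H1); auto. }
      { tauto. }
      assert (HRc1 : forall t, R1 (c1 t)) by (intros; apply (R_cell H1); auto).
      assert (HRc2 : forall t, R2 (c2 t)) by (intros; apply (R_cell H2); auto).
      exists (fun y => B y \/ C y). split; [apply (ia_union _ _ H2); auto|split].
      + intros y [Hy|Hy].
        * destruct (HBL y Hy) as (t & Ht & Hty). exists t; simpl; auto.
        * exists s; simpl; auto.
      + intros t [<-|Ht].
        * assert (HBs' : forall y, c2 s y -> ~ B y).
          { intros y Hy HBy. destruct (HBL y HBy) as (t & Ht & Hty).
            assert (s = t) by (eapply cell_disjoint; eauto). congruence. }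
          split.
          -- apply (similar_extQ H2 _ _ C); auto.
             intros y. specialize (HBs' y). specialize (HCs y). tauto.
          -- eapply (similar_extP H1); [|eapply (similar_extQ H2); [|apply Hs2|]|].
             ++ intros x; unfold minus; simpl. tauto.
             ++ intros y. unfold minus. specialize (HBs' y). tauto.
             ++ eapply ia_minus; eauto.
             ++ eapply ia_minus; eauto. apply (R_inter H1); auto.
        * assert (HCt : forall y, c2 t y -> ~ C y).
          { intros y Hy HCy. apply HCs in HCy.
            assert (s = t) by (eapply cell_disjoint; eauto). congruence. }
          destruct (HBs t Ht) as [Ht1 Ht2]. split.
          -- eapply (similar_extQ H2); [|apply Ht1|].
             ++ intros y. specialize (HCt y). tauto.
             ++ apply (R_inter H2); auto.
          -- eapply (similar_extQ H2); [|apply Ht2|].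
             ++ intros y. unfold minus. specialize (HCt y). tauto.
             ++ eapply ia_minus; eauto. }
  destruct (HL (signs (length env1)) (nodup_signs _)) as (B & HB & _ & HBs).
  exists B. split; auto. split; [auto|split; [auto|split; [simpl; congruence|]]].
  assert (HRc1 : forall t, R1 (c1 t)) by (intros; apply (R_cell H1); auto).
  assert (HRc2 : forall t, R2 (c2 t)) by (intros; apply (R_cell H2); auto).
  intros [|b s]; simpl; [apply similar_empty|].
  fold c1 c2.
  destruct (Nat.eq_dec (length s) (length env1)) as [Hs|Hs].
  - destruct (HBs s) as [Ht1 Ht2]; [now apply in_signs|]. destruct b.
    + eapply (similar_extP H1); [|eapply (similar_extQ H2); [|apply Ht1|]|].
      * intros x; simpl; tauto.
      * intros y; simpl; tauto.
      * apply (R_inter H2); auto.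
      * apply (R_inter H1); auto.
    + eapply (similar_extP H1); [|eapply (similar_extQ H2); [|apply Ht2|]|].
      * intros x; unfold minus; simpl; intuition discriminate.
      * intros y; unfold minus; simpl; intuition discriminate.
      * eapply ia_minus; eauto.
      * eapply ia_minus; eauto.
  (* A sign vector of the wrong length describes an empty cell on both sides. *)
  - eapply (similar_extP H1); [|eapply (similar_extQ H2); [|apply similar_empty|]|].
    + intros x. split; [tauto|]. intros [Hc _]. apply Hs. eapply cell_length; eauto.
    + intros y. split; [tauto|]. intros [Hc _]. apply Hs. rewrite Hlen.
      eapply cell_length; eauto.
    + eapply ia_ideal, ia_empty; eauto.
    + eapply ia_ideal, ia_empty; eauto.
Qed.

End Game.

Lemma similar_sym {X Y : Type} (S1 : (X -> Prop) -> Prop) (S2 : (Y -> Prop) -> Prop) k P Q :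
  similar S1 S2 k P Q -> similar S2 S1 k Q P.
Proof. intros [Hn HS]. split; [|tauto]. intros n Hle. rewrite Hn; tauto. Qed.

Lemma position_sym {X Y : Type} {R1 S1 : (X -> Prop) -> Prop}
  {R2 S2 : (Y -> Prop) -> Prop} k env1 env2 :
  position (R1 := R1) (S1 := S1) (R2 := R2) (S2 := S2) k env1 env2 ->
  position (R1 := R2) (S1 := S2) (R2 := R1) (S2 := S1) k env2 env1.
Proof.
  intros (HR1 & HR2 & Hlen & Hsim). split; [auto|split; [auto|split; [auto|]]].
  intros s. apply similar_sym, Hsim.
Qed.

(** Inclusion says that certain cells are empty, and emptiness is visible even at the smallest
    threshold 2^0 = 1: a point [y] of [Q] has a counterpart [x] in the cell with the same signs,
    where the inclusion is known. *)
Lemma position_sub {X Y : Type} {R1 S1 : (X -> Prop) -> Prop}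
  {R2 S2 : (Y -> Prop) -> Prop} k env1 env2 i j P P' Q Q' :
  position (R1 := R1) (S1 := S1) (R2 := R2) (S2 := S2) k env1 env2 ->
  nth_error env1 i = Some P -> nth_error env1 j = Some P' ->
  nth_error env2 i = Some Q -> nth_error env2 j = Some Q' ->
  (forall x, P x -> P' x) -> forall y, Q y -> Q' y.
Proof.
  intros (HR1 & HR2 & Hlen & Hsim) HP HP' HQ HQ' Hsub y Hy.
  destruct (cell_cover (top (R := R2)) env2 y) as (s & Hs).
  { exists Q. split; auto. rewrite Forall_forall in HR2. eapply HR2, nth_error_In; eauto. }
  assert (Hx : at_least 1 (cell (top (R := R1)) env1 s)).
  { apply (Hsim s).
    - change 1 with (2 ^ 0). apply Nat.pow_le_mono_r; lia.
    - apply at_least_1; eauto. }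
  rewrite at_least_1 in Hx. destruct Hx as (x & Hx).
  apply (cell_nth _ _ _ _ _ _ Hs HQ').
  apply (cell_nth _ _ _ _ _ _ Hx HP'), Hsub, (cell_nth _ _ _ _ _ _ Hx HP).
  now apply (cell_nth _ _ _ _ _ _ Hs HQ).
Qed.

(** If [P] is small then so is every cell inside it; similarity carries this over to the cells
    inside [Q], and [S_cells] reassembles [Q] from them. *)
Lemma position_small {X Y : Type} {R1 S1 : (X -> Prop) -> Prop}
  {R2 S2 : (Y -> Prop) -> Prop}
  (H1 : ideal_algebra R1 S1) (H2 : ideal_algebra R2 S2) k env1 env2 i P Q :
  position (R1 := R1) (S1 := S1) (R2 := R2) (S2 := S2) k env1 env2 ->
  nth_error env1 i = Some P -> nth_error env2 i = Some Q -> S1 P -> S2 Q.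
Proof.
  intros (HR1 & HR2 & Hlen & Hsim) HP HQ HS.
  assert (HRQ : R2 Q).
  { rewrite Forall_forall in HR2. eapply HR2, nth_error_In; eauto. }
  apply (S_cells H2 env2); auto. intros s.
  destruct (classic (nth_error s i = Some true)) as [Hi|Hi].
  - apply (S_ext H2 (cell (top (R := R2)) env2 s)).
    + intros y; split; [|tauto]. intros Hy; split; auto.
      now apply (cell_nth _ _ _ _ _ _ Hy HQ).
    + apply (Hsim s). apply (ia_down _ _ H1 _ P); auto.
      * now apply R_cell with (1 := H1).
      * intros x Hx. now apply (cell_nth _ _ _ _ _ _ Hx HP).
  - apply (S_ext H2 (fun _ => False)); [|apply (ia_empty _ _ H2)].
    intros y; split; [tauto|]. intros [Hy Hc].
    now apply Hi, (cell_nth _ _ _ _ _ _ Hc HQ).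
Qed.

(** * From the game to elementary equivalence *)

Fixpoint qdepth (p : bform) : nat :=
  match p with
  | BSub _ _ | BEq _ _ | BS _ => 0
  | BNot q => qdepth q
  | BAnd q r => Nat.max (qdepth q) (qdepth r)
  | BEx q => S (qdepth q)
  end.

(** Presents a structure as a field of sets, [el a] being the set of points of [a]. Asking in
    [rep_onto] for pointwise equivalence only avoids extensionality of predicates. *)
Record represents {A X : Type} (le : A -> A -> Prop) (Sp : A -> Prop)
  (el : A -> X -> Prop) (R S : (X -> Prop) -> Prop) : Prop := {
  rep_alg : ideal_algebra R S;
  rep_el : forall a, R (el a);
  rep_onto : forall P, R P -> exists a, forall x, el a x <-> P x;
  rep_le : forall a b, le a b <-> forall x, el a x -> el b x;
  rep_ext : forall a b, (forall x, el a x <-> el b x) -> a = b;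
  rep_small : forall a, Sp a <-> S (el a)
}.

Section Transfer.
Context {A X : Type} {leA : A -> A -> Prop} {SA : A -> Prop} {elA : A -> X -> Prop}
  {R1 S1 : (X -> Prop) -> Prop}.
Context {B Y : Type} {leB : B -> B -> Prop} {SB : B -> Prop} {elB : B -> Y -> Prop}
  {R2 S2 : (Y -> Prop) -> Prop}.
Hypothesis (HA : represents leA SA elA R1 S1) (HB : represents leB SB elB R2 S2).

Definition related k (e1 : list A) (e2 : list B) : Prop :=
  position (R1 := R1) (S1 := S1) (R2 := R2) (S2 := S2) k (map elA e1) (map elB e2).

Lemma related_step k e1 e2 a : related (S k) e1 e2 ->
  exists b, related k (a :: e1) (b :: e2).
Proof.
  intros Hr.
  destruct (position_step (rep_alg _ _ _ _ _ HA) (rep_alg _ _ _ _ _ HB) k _ _ (elA a) Hr)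
    as (Q & HQ & Hpos); [apply (rep_el _ _ _ _ _ HA)|].
  destruct (rep_onto _ _ _ _ _ HB Q HQ) as (b & Hb).
  exists b. destruct Hpos as (HR1 & HR2 & Hlen & Hsim).
  assert (HR2' : Forall R2 (map elB (b :: e2))).
  { simpl in *. inversion HR2; subst. constructor; auto. apply (rep_el _ _ _ _ _ HB). }
  split; [auto|split; [auto|split; [auto|]]].
  intros s. eapply (similar_extQ (rep_alg _ _ _ _ _ HB)); [|apply (Hsim s)|].
  - destruct s as [|c s]; simpl; intros y; [tauto|]. rewrite Hb. tauto.
  - apply (R_cell (rep_alg _ _ _ _ _ HB)); auto.
Qed.

Lemma related_nth k e1 e2 i : related k e1 e2 ->
  (nth_error e1 i = None /\ nth_error e2 i = None) \/
  exists a b, nth_error e1 i = Some a /\ nth_error e2 i = Some b /\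
    nth_error (map elA e1) i = Some (elA a) /\ nth_error (map elB e2) i = Some (elB b).
Proof.
  intros (_ & _ & Hlen & _). rewrite !length_map in Hlen. rewrite !nth_error_map.
  destruct (nth_error e1 i) as [a|] eqn:Ea, (nth_error e2 i) as [b|] eqn:Eb; auto.
  - right. exists a, b. auto.
  - apply nth_error_None in Eb. assert (nth_error e1 i <> None) by congruence.
    apply nth_error_Some in H. lia.
  - apply nth_error_None in Ea. assert (nth_error e2 i <> None) by congruence.
    apply nth_error_Some in H. lia.
Qed.

End Transfer.

Lemma related_sym {A X : Type} {elA : A -> X -> Prop} {R1 S1 : (X -> Prop) -> Prop}
  {B Y : Type} {elB : B -> Y -> Prop} {R2 S2 : (Y -> Prop) -> Prop} k e1 e2 :
  related (elA := elA) (R1 := R1) (S1 := S1) (elB := elB) (R2 := R2) (S2 := S2) k e1 e2 ->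
  related (elA := elB) (R1 := R2) (S1 := S2) (elB := elA) (R2 := R1) (S2 := S1) k e2 e1.
Proof. apply position_sym. Qed.

Lemma related_sub {A X : Type} {leA : A -> A -> Prop} {SA : A -> Prop}
  {elA : A -> X -> Prop} {R1 S1 : (X -> Prop) -> Prop}
  {B Y : Type} {leB : B -> B -> Prop} {SB : B -> Prop} {elB : B -> Y -> Prop}
  {R2 S2 : (Y -> Prop) -> Prop}
  (HA : represents leA SA elA R1 S1) (HB : represents leB SB elB R2 S2) k e1 e2 :
  related (elA := elA) (R1 := R1) (S1 := S1) (elB := elB) (R2 := R2) (S2 := S2) k e1 e2 ->
  forall i j a a' b b', nth_error e1 i = Some a -> nth_error e1 j = Some a' ->
  nth_error e2 i = Some b -> nth_error e2 j = Some b' -> leA a a' -> leB b b'.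
Proof.
  intros Hr i j a a' b b' Ha Ha' Hb Hb' Hle.
  apply (rep_le _ _ _ _ _ HB).
  apply (position_sub k _ _ i j (elA a) (elA a') _ _ Hr);
    rewrite ?nth_error_map, ?Ha, ?Ha', ?Hb, ?Hb'; auto.
  now apply (rep_le _ _ _ _ _ HA).
Qed.

Lemma related_sat {A X : Type} {leA : A -> A -> Prop} {SA : A -> Prop}
  {elA : A -> X -> Prop} {R1 S1 : (X -> Prop) -> Prop}
  {B Y : Type} {leB : B -> B -> Prop} {SB : B -> Prop} {elB : B -> Y -> Prop}
  {R2 S2 : (Y -> Prop) -> Prop}
  (HA : represents leA SA elA R1 S1) (HB : represents leB SB elB R2 S2) p :
  forall k e1 e2, qdepth p <= k ->
  related (elA := elA) (R1 := R1) (S1 := S1) (elB := elB) (R2 := R2) (S2 := S2) k e1 e2 ->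
  (sat leA SA e1 p <-> sat leB SB e2 p).
Proof.
  induction p as [i j|i j|i|p IH|p IHp q IHq|p IH]; intros k e1 e2 Hk Hr; simpl in *.
  - destruct (related_nth k e1 e2 i Hr) as [[-> ->]|(a & b & Ha & Hb & _)]; [tauto|].
    destruct (related_nth k e1 e2 j Hr) as [[-> ->]|(a' & b' & Ha' & Hb' & _)];
      [rewrite Ha, Hb; tauto|].
    rewrite Ha, Hb, Ha', Hb'. split.
    + apply (related_sub HA HB k e1 e2 Hr i j); auto.
    + apply (related_sub HB HA k e2 e1 (related_sym _ _ _ Hr) i j); auto.
  - destruct (related_nth k e1 e2 i Hr) as [[-> ->]|(a & b & Ha & Hb & _)]; [tauto|].
    destruct (related_nth k e1 e2 j Hr) as [[-> ->]|(a' & b' & Ha' & Hb' & _)];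
      [rewrite Ha, Hb; tauto|].
    rewrite Ha, Hb, Ha', Hb'.
    (* Equality is mutual inclusion, so this atomic case reduces to the previous one. *)
    assert (HAeq : a = a' <-> leA a a' /\ leA a' a).
    { rewrite !(rep_le _ _ _ _ _ HA). split; [intros ->; auto|].
      intros [? ?]. apply (rep_ext _ _ _ _ _ HA). intros; split; auto. }
    assert (HBeq : b = b' <-> leB b b' /\ leB b' b).
    { rewrite !(rep_le _ _ _ _ _ HB). split; [intros ->; auto|].
      intros [? ?]. apply (rep_ext _ _ _ _ _ HB). intros; split; auto. }
    rewrite HAeq, HBeq.
    pose proof (related_sub HA HB k e1 e2 Hr) as Hs1.
    pose proof (related_sub HB HA k e2 e1 (related_sym _ _ _ Hr)) as Hs2.
    split; intros [? ?]; split; eauto.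
  - destruct (related_nth k e1 e2 i Hr) as [[-> ->]|(a & b & Ha & Hb & Ha' & Hb')]; [tauto|].
    rewrite Ha, Hb. rewrite (rep_small _ _ _ _ _ HA), (rep_small _ _ _ _ _ HB). split.
    + now apply (position_small (rep_alg _ _ _ _ _ HA) (rep_alg _ _ _ _ _ HB) k _ _ i _ _ Hr).
    + now apply (position_small (rep_alg _ _ _ _ _ HB) (rep_alg _ _ _ _ _ HA) k _ _ i _ _
        (position_sym _ _ _ Hr)).
  - now rewrite (IH k e1 e2).
  - rewrite (IHp k e1 e2), (IHq k e1 e2); auto; [tauto|lia|lia].
  - destruct k as [|k]; [lia|]. split.
    + intros (a & Ha). destruct (related_step HA HB k e1 e2 a Hr) as (b & Hb).
      exists b. apply (IH k (a :: e1)); auto. lia.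
    + intros (b & Hb).
      destruct (related_step HB HA k e2 e1 b (related_sym _ _ _ Hr)) as (a & Ha).
      apply related_sym in Ha.
      exists a. apply (IH k (a :: e1) (b :: e2)); auto. lia.
Qed.

Theorem represents_elem_equiv {A X : Type} {leA : A -> A -> Prop} {SA : A -> Prop}
  {elA : A -> X -> Prop} {R1 S1 : (X -> Prop) -> Prop}
  {B Y : Type} {leB : B -> B -> Prop} {SB : B -> Prop} {elB : B -> Y -> Prop}
  {R2 S2 : (Y -> Prop) -> Prop} :
  represents leA SA elA R1 S1 -> represents leB SB elB R2 S2 ->
  elem_equiv leA SA leB SB.
Proof.
  intros HA HB p _. apply (related_sat HA HB p (qdepth p) [] []); auto.
  apply position_nil; [apply (rep_alg _ _ _ _ _ HA)|apply (rep_alg _ _ _ _ _ HB)].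
Qed.

(** * Class comprehension without syntax *)

Section SetTheory.
Context {M : Type} {mem : M -> M -> Prop} (HM : GBC M mem).

Local Notation "x ∈ y" := (mem x y) (at level 70).
Local Notation "x ⊆ y" := (subclass M mem x y) (at level 70).
Local Notation set := (isSet M mem).
Local Notation opair := (is_opair M mem).
Local Notation pair_in := (pair_in M mem).
Local Notation functional := (functional M mem).
Local Notation ordinal := (ordinal M mem).
Local Notation card_le := (card_le M mem).
Local Notation card_lt := (card_lt M mem).
Local Notation card_eq := (card_eq M mem).

Fixpoint rename (r : nat -> nat) (p : eform) : eform :=
  match p with
  | EMem i j => EMem (r i) (r j)
  | EEq i j => EEq (r i) (r j)
  | ENot q => ENot (rename r q)
  | EAnd q q' => EAnd (rename r q) (rename r q')
  | EEx q => EEx (rename (fun k => match k with 0 => 0 | S k => S (r k) end) q)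
  end.

Lemma eval_rename p : forall r e e', (forall k, e (r k) = e' k) ->
  (eval M mem e (rename r p) <-> eval M mem e' p).
Proof.
  induction p as [i j|i j|p IH|p IHp q IHq|p IH]; intros r e e' He; simpl.
  - now rewrite !He.
  - now rewrite !He.
  - now rewrite (IH r e e').
  - now rewrite (IHp r e e'), (IHq r e e').
  - assert (Hs : forall x, eval M mem (scons x e)
        (rename (fun k => match k with 0 => 0 | S k => S (r k) end) p) <->
        eval M mem (scons x e') p).
    { intros x. apply IH. intros [|k]; simpl; auto. }
    split; intros (x & Hx & Hp); exists x; split; auto; now apply Hs.
Qed.

(* Even positions hold the variables of a formula, odd ones its class parameters. *)
Definition mix (e p : nat -> M) (k : nat) : M :=
  if Nat.even k then e (Nat.div2 k) else p (Nat.div2 k).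

Definition definable (P : (nat -> M) -> Prop) : Prop :=
  exists phi p, forall e, P e <-> eval M mem (mix e p) phi.

Lemma mix_even e p k : mix e p (2 * k) = e k.
Proof. unfold mix. now rewrite Nat.even_even, Nat.div2_double. Qed.

Lemma mix_odd e p k : mix e p (S (2 * k)) = p k.
Proof.
  unfold mix. replace (S (2 * k)) with (2 * k + 1) at 1 by lia.
  now rewrite Nat.even_odd, Nat.div2_succ_double.
Qed.

Lemma parity k : (exists j, k = 2 * j) \/ (exists j, k = S (2 * j)).
Proof.
  destruct (Nat.Even_or_Odd k) as [[j ->]|[j ->]]; [left|right]; exists j; lia.
Qed.

Lemma definable_iff P Q : (forall e, P e <-> Q e) -> definable P -> definable Q.
Proof. intros HPQ (phi & p & Hp). exists phi, p. intros e. now rewrite <- HPQ. Qed.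

Lemma definable_not P : definable P -> definable (fun e => ~ P e).
Proof. intros (phi & p & Hp). exists (ENot phi), p. intros e; simpl. now rewrite Hp. Qed.

Lemma definable_and P Q : definable P -> definable Q -> definable (fun e => P e /\ Q e).
Proof.
  intros (phi & p & Hp) (psi & q & Hq).
  (* The parameters of the two formulas are interleaved once more: parameter [j] of [phi] becomes
     parameter [2 * j], that of [psi] becomes [2 * j + 1]. Variables stay where they are. *)
  set (r b k := if Nat.even k then k else S (2 * (2 * Nat.div2 k + b))).
  exists (EAnd (rename (r 0) phi) (rename (r 1) psi)), (mix p q).
  intros e. simpl. rewrite Hp, Hq.
  rewrite (eval_rename phi (r 0) _ (mix e p)), (eval_rename psi (r 1) _ (mix e q)); [tauto| |];
    intros k; unfold r; destruct (parity k) as [[j ->]|[j ->]].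
  - now rewrite Nat.even_even, !mix_even.
  - replace (Nat.even (S (2 * j))) with false
      by (replace (S (2 * j)) with (2 * j + 1) by lia; now rewrite Nat.even_odd).
    rewrite Nat.div2_succ_double, !mix_odd.
    replace (2 * j + 1) with (S (2 * j)) by lia. now rewrite mix_odd.
  - now rewrite Nat.even_even, !mix_even.
  - replace (Nat.even (S (2 * j))) with false
      by (replace (S (2 * j)) with (2 * j + 1) by lia; now rewrite Nat.even_odd).
    rewrite Nat.div2_succ_double, !mix_odd, Nat.add_0_r. now rewrite mix_even.
Qed.

(** A new bound variable shifts the variables but not the parameters. This maps a position of
    [mix (scons x e) p] to the position of the same object in [scons x (mix e p)]. *)
Definition shift_index (k : nat) : nat :=
  match k with 0 => 0 | S j => if Nat.even k then j else S k end.

Lemma mix_scons x e p k : scons x (mix e p) (shift_index k) = mix (scons x e) p k.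
Proof.
  destruct (parity k) as [[[|j] ->]|[j ->]].
  - reflexivity.
  - rewrite mix_even. replace (2 * S j) with (S (S (2 * j))) by lia. simpl shift_index.
    replace (Nat.even (j + (j + 0))) with true
      by (symmetry; replace (j + (j + 0)) with (2 * j) by lia; apply Nat.even_even).
    simpl scons. apply (mix_even e p j).
  - rewrite mix_odd. unfold shift_index.
    replace (Nat.even (S (2 * j))) with false
      by (replace (S (2 * j)) with (2 * j + 1) by lia; now rewrite Nat.even_odd).
    simpl scons. apply (mix_odd e p j).
Qed.

Lemma definable_ex Q : definable (fun e => Q (e 0) (fun k => e (S k))) ->
  definable (fun e => exists x, set x /\ Q x e).
Proof.
  intros (phi & p & Hp). exists (EEx (rename shift_index phi)), p. intros e. simpl.
  assert (Hx : forall x, Q x e <-> eval M mem (scons x (mix e p)) (rename shift_index phi)).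
  { intros x. rewrite (eval_rename phi shift_index _ (mix (scons x e) p)).
    - rewrite <- (Hp (scons x e)). reflexivity.
    - apply mix_scons. }
  split; intros (x & Hs & H); exists x; split; auto; now apply Hx.
Qed.

(** Constants may be proper classes; they are how class parameters enter a definable predicate. *)
Definition term (t : (nat -> M) -> M) : Prop :=
  (exists i, forall e, t e = e i) \/ (exists c, forall e, t e = c).

Lemma term_var i : term (fun e => e i).
Proof. left. now exists i. Qed.

Lemma term_const c : term (fun _ => c).
Proof. right. now exists c. Qed.

Lemma term_map t r : term t -> term (fun e => t (fun k => e (r k))).
Proof.
  intros [[i Hi]|[c Hc]]; [left; exists (r i)|right; exists c]; intros e.
  - apply (Hi (fun k => e (r k))).
  - apply Hc.
Qed.

(** [b] is the parameter slot reserved for the term, so that the two terms of an atomic formula can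
    use slots 0 and 1. *)
Lemma term_index t : term t ->
  exists (i : nat -> nat) c, forall e p b, p b = c -> t e = mix e p (i b).
Proof.
  intros [[i Hi]|[c Hc]].
  (* A variable occupies no slot; [w] is only a default value. *)
  - destruct (ax_inf M mem HM) as (w & _). exists (fun _ => 2 * i), w.
    intros e p b _. now rewrite Hi, mix_even.
  - exists (fun b => S (2 * b)), c. intros e p b <-. now rewrite mix_odd, Hc.
Qed.

Lemma definable_mem t s : term t -> term s -> definable (fun e => t e ∈ s e).
Proof.
  intros Ht Hs.
  destruct (term_index t Ht) as (i & c & Hi), (term_index s Hs) as (j & d & Hj).
  exists (EMem (i 0) (j 1)), (fun k => match k with 0 => c | _ => d end).
  intros e. simpl. now rewrite <- Hi, <- Hj.
Qed.

Lemma definable_eq t s : term t -> term s -> definable (fun e => t e = s e).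
Proof.
  intros Ht Hs.
  destruct (term_index t Ht) as (i & c & Hi), (term_index s Hs) as (j & d & Hj).
  exists (EEq (i 0) (j 1)), (fun k => match k with 0 => c | _ => d end).
  intros e. simpl. now rewrite <- Hi, <- Hj.
Qed.

Lemma definable_or P Q : definable P -> definable Q -> definable (fun e => P e \/ Q e).
Proof.
  intros HP HQ. apply (definable_iff (fun e => ~ (~ P e /\ ~ Q e))).
  - intros e. destruct (classic (P e)), (classic (Q e)); tauto.
  - apply definable_not, definable_and; now apply definable_not.
Qed.

Lemma definable_imp P Q : definable P -> definable Q -> definable (fun e => P e -> Q e).
Proof.
  intros HP HQ. apply (definable_iff (fun e => ~ (P e /\ ~ Q e))).
  - intros e. destruct (classic (P e)), (classic (Q e)); tauto.
  - apply definable_not, definable_and; auto. now apply definable_not.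
Qed.

Lemma definable_equiv P Q : definable P -> definable Q -> definable (fun e => P e <-> Q e).
Proof. intros HP HQ. apply definable_and; now apply definable_imp. Qed.

Lemma definable_all Q : definable (fun e => Q (e 0) (fun k => e (S k))) ->
  definable (fun e => forall x, set x -> Q x e).
Proof.
  intros HQ. apply (definable_iff (fun e => ~ exists x, set x /\ ~ Q x e)).
  - intros e. split.
    + intros Hno x Hx. apply NNPP. intros HQx. apply Hno. eauto.
    + intros Hall (x & Hx & HQx). auto.
  - apply definable_not. apply (definable_ex (fun x e => ~ Q x e)). now apply definable_not.
Qed.

(** Quantifying over all terms builds in substitution: each argument may later be a variable or a
    class parameter. *)
Definition def1 (P : M -> Prop) : Prop :=
  forall t, term t -> definable (fun e => P (t e)).
Definition def2 (P : M -> M -> Prop) : Prop :=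
  forall t1 t2, term t1 -> term t2 -> definable (fun e => P (t1 e) (t2 e)).
Definition def3 (P : M -> M -> M -> Prop) : Prop :=
  forall t1 t2 t3, term t1 -> term t2 -> term t3 ->
  definable (fun e => P (t1 e) (t2 e) (t3 e)).
Definition def4 (P : M -> M -> M -> M -> Prop) : Prop :=
  forall t1 t2 t3 t4, term t1 -> term t2 -> term t3 -> term t4 ->
  definable (fun e => P (t1 e) (t2 e) (t3 e) (t4 e)).

Ltac solve_term :=
  cbv beta; 
  lazymatch goal with
  | |- term (fun e => ?t (fun k => e (@?r k))) => apply (term_map t r); assumption
  | _ => first [assumption | apply term_var | apply term_const]
  end.

(** A hook, redefined below once the basic predicates on sets and pairs are known to be
    definable. *)
Ltac dfn_lemma := fail.

(** Quantifiers are recognised only in the guarded shapes [exists x, set x /\ _] and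
    [forall x, set x -> _], which is why so many predicates below carry explicit [set] guards. *)
Ltac dfn_step :=
  cbv beta;
  lazymatch goal with
  | |- term _ => solve_term
  | |- definable (fun e => ~ @?P e) => apply (definable_not P)
  | |- definable (fun e => @?P e <-> @?Q e) => apply (definable_equiv P Q)
  | |- definable (fun e => @?P e /\ @?Q e) => apply (definable_and P Q)
  | |- definable (fun e => @?P e \/ @?Q e) => apply (definable_or P Q)
  | |- definable (fun e => exists x, set x /\ @?Q e x) => apply (definable_ex (fun x e => Q e x))
  | |- definable (fun e => forall x, set x -> @?Q e x) => apply (definable_all (fun x e => Q e x))
  | |- definable (fun e => @?P e -> @?Q e) => apply (definable_imp P Q)
  | |- definable (fun e => mem (@?t e) (@?s e)) => apply (definable_mem t s)
  | |- definable (fun e => @eq _ (@?t e) (@?s e)) => apply (definable_eq t s)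
  | |- definable _ =>
      first [ dfn_lemma
            | match goal with
              | H : def1 _ |- _ => apply H
              | H : def2 _ |- _ => apply H
              | H : def3 _ |- _ => apply H
              | H : def4 _ |- _ => apply H
              end ]
  end.

Ltac dfn :=
  lazymatch goal with
  | |- def1 _ => intros ? ?
  | |- def2 _ => intros ? ? ? ?
  | |- def3 _ => intros ? ? ? ? ? ?
  | |- def4 _ => intros ? ? ? ? ? ? ? ?
  | _ => idtac
  end; repeat dfn_step.

(** * Elementary set theory inside the model *)

Lemma set_mem x y : x ∈ y -> set x.
Proof. now exists y. Qed.

Lemma ext x y : (forall z, z ∈ x <-> z ∈ y) -> x = y.
Proof. apply (ax_ext M mem HM). Qed.

Lemma class_of P : def1 P -> exists C, forall x, x ∈ C <-> set x /\ P x.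
Proof.
  intros HP. destruct (HP (fun e => e 0) (term_var 0)) as (phi & p & Hp).
  (* The truth of [P (e 0)] depends on variable 0 alone, so [p] also serves as a dummy environment
     for the other variables. *)
  destruct (ax_compr M mem HM (rename shift_index phi) (mix p p)) as (C & HC).
  assert (Hx : forall x, P x <-> eval M mem (scons x (mix p p)) (rename shift_index phi)).
  { intros x. rewrite (eval_rename phi shift_index _ (mix (scons x p) p)).
    - rewrite <- (Hp (scons x p)). reflexivity.
    - apply mix_scons. }
  exists C. intros x. split.
  - intros Hin. assert (Hs := set_mem _ _ Hin). split; auto. now apply Hx, HC.
  - intros [Hs HPx]. now apply HC, Hx.
Qed.

Lemma sep a P : set a -> def1 P -> exists b, set b /\ forall x, x ∈ b <-> x ∈ a /\ P x.
Proof.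
  intros Ha HP. destruct (class_of P HP) as (C & HC).
  destruct (ax_sep M mem HM a C Ha) as (b & Hb & Hbx).
  exists b. split; auto. intros x. rewrite Hbx, HC.
  split; [tauto|]. intros [Hxa HPx]. split; auto. split; auto. now apply set_mem in Hxa.
Qed.

Lemma set_sub x y : set y -> x ⊆ y -> set x.
Proof.
  intros Hy Hxy. destruct (ax_sep M mem HM y x Hy) as (b & Hb & Hbx).
  replace x with b; auto. apply ext. intros z. rewrite Hbx. split; [tauto|]. auto.
Qed.

Lemma least P : def1 P -> (exists x, set x /\ P x) ->
  exists x, set x /\ P x /\ forall y, y ∈ x -> ~ P y.
Proof.
  intros HP (x0 & Hx0 & HPx0). destruct (class_of P HP) as (C & HC).
  destruct (ax_found M mem HM C) as (x & Hx & Hmin); [exists x0; now apply HC|].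
  apply HC in Hx as [Hx HPx]. exists x. split; auto. split; auto.
  intros y Hy HPy. apply (Hmin y Hy), HC. split; auto. now apply set_mem in Hy.
Qed.

Lemma mem_induction P : def1 P ->
  (forall x, set x -> (forall y, y ∈ x -> P y) -> P x) -> forall x, set x -> P x.
Proof.
  intros HP Hind x Hx. apply NNPP. intros HnP.
  destruct (least (fun x => ~ P x)) as (y & Hy & HnPy & Hmin); [dfn|eauto|].
  apply HnPy, Hind; auto. intros z Hz. now apply NNPP, Hmin.
Qed.

Lemma pair_ex a b : set a -> set b -> exists p, set p /\ forall z, z ∈ p <-> z = a \/ z = b.
Proof. apply (ax_pair M mem HM). Qed.

Lemma union_ex a b : set a -> set b -> exists u, set u /\ forall z, z ∈ u <-> z ∈ a \/ z ∈ b.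
Proof.
  intros Ha Hb. destruct (pair_ex a b Ha Hb) as (p & Hp & Hpz).
  destruct (ax_union M mem HM p Hp) as (u & Hu & Huz).
  exists u. split; auto. intros z. rewrite Huz. split.
  - intros (y & Hzy & Hy). apply Hpz in Hy as [->| ->]; auto.
  - intros [Hz|Hz]; [exists a|exists b]; split; auto; apply Hpz; auto.
Qed.

Lemma empty_ex : exists o, set o /\ forall z, ~ z ∈ o.
Proof.
  destruct (ax_inf M mem HM) as (w & _ & (o & Ho & Hz) & _).
  exists o. split; auto. now apply set_mem in Ho.
Qed.

Lemma adjoin_ex a b : set a -> set b -> exists u, set u /\ forall z, z ∈ u <-> z ∈ a \/ z = b.
Proof.
  intros Ha Hb. destruct (pair_ex b b Hb Hb) as (p & Hp & Hpz).
  destruct (union_ex a p Ha Hp) as (u & Hu & Huz).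
  exists u. split; auto. intros z. rewrite Huz, Hpz. tauto.
Qed.

Lemma no_loop1 x : ~ x ∈ x.
Proof.
  intros Hx. assert (Hs := set_mem _ _ Hx).
  destruct (least (fun y => y = x)) as (y & _ & -> & Hmin); [dfn|eauto|].
  now apply (Hmin x).
Qed.

Lemma no_loop2 x y : x ∈ y -> ~ y ∈ x.
Proof.
  intros Hxy Hyx. assert (Hs := set_mem _ _ Hxy).
  destruct (least (fun z => z = x \/ z = y)) as (z & _ & [-> | ->] & Hmin); [dfn|eauto| |].
  - now apply (Hmin y); auto.
  - now apply (Hmin x); auto.
Qed.

Lemma no_loop3 x y z : x ∈ y -> y ∈ z -> ~ z ∈ x.
Proof.
  intros Hxy Hyz Hzx. assert (Hs := set_mem _ _ Hxy).
  destruct (least (fun w => w = x \/ (w = y \/ w = z))) as (w & _ & [-> |[-> | ->]] & Hmin);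
    [dfn|eauto| | |].
  - now apply (Hmin z); auto.
  - now apply (Hmin x); auto.
  - now apply (Hmin y); auto.
Qed.

(** [isSet] hides a quantifier over classes; being equal to some set is a predicative equivalent. *)
Lemma def_set : def1 set.
Proof.
  intros t Ht. apply (definable_iff (fun e => exists y, set y /\ y = t e)).
  - intros e. split; [intros (y & Hy & <-); auto|eauto].
  - dfn.
Qed.

Lemma def_sub : def2 (subclass M mem).
Proof.
  intros t s Ht Hs. apply (definable_iff (fun e => forall z, set z -> z ∈ t e -> z ∈ s e)).
  - intros e. unfold subclass. split; eauto using set_mem.
  - dfn.
Qed.

(** The quantifier in [is_pair] runs over all classes and thereby forces both components to be sets;
    the predicative version has to demand this separately. *)
Lemma def_pair : def3 (is_pair M mem).
Proof.
  intros t a b Ht Ha Hb.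
  apply (definable_iff (fun e => (exists x, set x /\ x = a e) /\ (exists x, set x /\ x = b e) /\
    forall z, set z -> (z ∈ t e <-> z = a e \/ z = b e))).
  - intros e. split.
    + intros ((x & Hx & <-) & (y & Hy & <-) & Hz) z. split.
      * intros Hzt. apply Hz; auto. now apply set_mem in Hzt.
      * intros [-> | ->]; apply Hz; auto.
    + intros Hp. repeat split; try (apply Hp).
      * exists (a e). split; auto. apply (set_mem _ (t e)), Hp; auto.
      * exists (b e). split; auto. apply (set_mem _ (t e)), Hp; auto.
  - dfn.
Qed.

Lemma opair_set p x y : opair p x y -> set x /\ set y.
Proof.
  intros (s & t & Hs & Ht & Hp). split.
  - apply (set_mem x s), Hs; auto.
  - apply (set_mem y t), Ht; auto.
Qed.

Lemma def_opair : def3 opair.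
Proof.
  intros t a b Ht Ha Hb.
  apply (definable_iff (fun e => exists s, set s /\ exists u, set u /\
    (is_pair M mem s (a e) (a e) /\ (is_pair M mem u (a e) (b e) /\ is_pair M mem (t e) s u)))).
  - intros e. split.
    + intros (s & _ & u & _ & H). exists s, u; auto.
    + intros (s & u & Hs & Hu & Hp). exists s. split; [apply (set_mem _ (t e)), Hp; auto|].
      exists u. split; [apply (set_mem _ (t e)), Hp; auto|]. auto.
  - pose proof def_pair. dfn.
Qed.

Lemma def_pair_in : def3 pair_in.
Proof.
  intros a b f Ha Hb Hf.
  apply (definable_iff (fun e => exists p, set p /\ (opair p (a e) (b e) /\ p ∈ f e))).
  - intros e. split; intros (p & H); exists p; [tauto|]. split; [|tauto].
    destruct H as [_ H]. now apply set_mem in H.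
  - pose proof def_opair. dfn.
Qed.

Ltac dfn_lemma ::=
  first [apply def_set | apply def_sub | apply def_pair | apply def_opair | apply def_pair_in].

Lemma opair_ex x y : set x -> set y -> exists p, set p /\ opair p x y.
Proof.
  intros Hx Hy. destruct (pair_ex x x Hx Hx) as (s & Hs & Hsz).
  destruct (pair_ex x y Hx Hy) as (t & Ht & Htz).
  destruct (pair_ex s t Hs Ht) as (p & Hp & Hpz).
  exists p. split; auto. exists s, t. auto.
Qed.

Lemma opair_fun p p' x y : opair p x y -> opair p' x y -> p = p'.
Proof.
  intros (s & t & Hs & Ht & Hp) (s' & t' & Hs' & Ht' & Hp').
  assert (s = s') by (apply ext; intros z; now rewrite (Hs z), (Hs' z)).
  assert (t = t') by (apply ext; intros z; now rewrite (Ht z), (Ht' z)).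
  subst. apply ext. intros z. now rewrite (Hp z), (Hp' z).
Qed.

Lemma opair_inj p x y x' y' : opair p x y -> opair p x' y' -> x = x' /\ y = y'.
Proof.
  intros (s & t & Hs & Ht & Hp) (s' & t' & Hs' & Ht' & Hp').
  unfold is_pair in *.
  assert (Hxx : x = x').
  { assert (Hin : s ∈ p) by (apply Hp; auto). apply Hp' in Hin as [-> | ->].
    - symmetry. assert (Hx : x' ∈ s') by (apply Hs'; auto). apply Hs in Hx; tauto.
    - symmetry. assert (Hx : x' ∈ t') by (apply Ht'; auto). apply Hs in Hx; tauto. }
  subst x'. split; auto.
  assert (Hss : s = s') by (apply ext; intros z; now rewrite Hs, Hs'). subst s'.
  assert (Hy : y ∈ t) by (apply Ht; auto).
  assert (Hy' : y' ∈ t') by (apply Ht'; auto).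
  assert (Hin : t ∈ p) by (apply Hp; auto).
  assert (Hin' : t' ∈ p) by (apply Hp'; auto).
  apply Hp' in Hin as [-> | ->].
  - apply Hs in Hy. assert (y = x) by tauto. subst y.
    apply Hp in Hin' as [-> | ->]; apply Hs in Hy'; intuition congruence.
  - apply Ht' in Hy as [->|]; auto. apply Ht in Hy'. intuition congruence.
Qed.

Lemma pair_in_set x y F : pair_in x y F -> set x /\ set y.
Proof. intros (p & Hp & _). now apply opair_set in Hp. Qed.

Lemma relation_of R : def2 R ->
  exists F, forall x y, pair_in x y F <-> set x /\ set y /\ R x y.
Proof.
  intros HR.
  destruct (class_of (fun p => exists x, set x /\ exists y, set y /\ (opair p x y /\ R x y)))
    as (F & HF); [dfn|].
  exists F. intros x y. split.
  - intros (p & Hp & HpF). apply HF in HpF as (_ & x' & Hx & y' & Hy & Hp' & HRxy).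
    destruct (opair_inj _ _ _ _ _ Hp Hp') as [<- <-]. auto.
  - intros (Hx & Hy & HRxy). destruct (opair_ex x y Hx Hy) as (p & Hps & Hp).
    exists p. split; auto. apply HF. split; auto. exists x. split; auto. exists y. auto.
Qed.

Lemma replace_ex a R : set a -> def2 R ->
  (forall x y y', x ∈ a -> set y -> set y' -> R x y -> R x y' -> y = y') ->
  exists b, set b /\ forall y, y ∈ b <-> set y /\ exists x, x ∈ a /\ R x y.
Proof.
  intros Ha HR Hfun.
  destruct (relation_of (fun x y => x ∈ a /\ R x y)) as (F & HF); [dfn|].
  destruct (ax_repl M mem HM F a) as (b & Hb & Hby); auto.
  - intros x y y' H H'. apply HF in H as (? & ? & ? & ?). apply HF in H' as (? & ? & ? & ?).
    eauto.
  - exists b. split; auto. intros y. rewrite Hby. split.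
    + intros (x & Hx & H). apply HF in H as (? & ? & ? & ?). eauto.
    + intros (Hy & x & Hx & H). exists x. split; auto. apply HF.
      split; [now apply set_mem in Hx|auto].
Qed.

Lemma function_ex a R : set a -> def2 R ->
  (forall x y y', x ∈ a -> set y -> set y' -> R x y -> R x y' -> y = y') ->
  exists f, set f /\ (forall x y, pair_in x y f <-> x ∈ a /\ set y /\ R x y) /\
    forall p, p ∈ f -> exists x y, opair p x y.
Proof.
  intros Ha HR Hfun.
  destruct (replace_ex a (fun x p => exists y, set y /\ (opair p x y /\ R x y)))
    as (f & Hf & Hfp); auto.
  - dfn.
  - intros x p p' Hx _ _ (y & Hy & Hp & H) (y' & Hy' & Hp' & H').
    assert (y = y') by eauto. subst. eapply opair_fun; eauto.
  - exists f. split; auto. split.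
    + intros x y. split.
      * intros (p & Hp & Hpf). apply Hfp in Hpf as (_ & x' & Hx & y' & Hy & Hp' & H).
        destruct (opair_inj _ _ _ _ _ Hp Hp') as [<- <-]. auto.
      * intros (Hx & Hy & H). destruct (opair_ex x y) as (p & Hps & Hp); eauto using set_mem.
        exists p. split; auto. apply Hfp. split; auto. exists x. split; auto. exists y. auto.
    + intros p Hp. apply Hfp in Hp as (_ & x & _ & y & _ & Hp & _). eauto.
Qed.

(** * Recursion along classes linearly ordered by membership *)

(** [A] itself need not be a transitive class. This keeps the notion closed under subclasses, and
    Foundation makes the order a well-ordering. *)
Definition chain (A : M) : Prop :=
  (forall x y z, x ∈ A -> y ∈ A -> z ∈ A -> x ∈ y -> y ∈ z -> x ∈ z) /\
  (forall x y, x ∈ A -> y ∈ A -> x ∈ y \/ x = y \/ y ∈ x).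

Section Recursion.
Context (A : M) (H : M -> M -> M -> M -> Prop).

(** The recursion prescribes the value at [b] as the union, over the earlier [c] in [A], of the
    contributions [{z | H b c w z}], where [w] is the value at [c]. *)
Definition is_value (f b v : M) : Prop :=
  forall z, set z -> (z ∈ v <-> exists c, set c /\ (c ∈ A /\ c ∈ b /\
    exists w, set w /\ (pair_in c w f /\ H b c w z))).

(** Partial solutions are sets with a domain closed downwards in [A]; quantifying over them stays
    predicative, so the full solution can be defined as their union. *)
Definition attempt (f : M) : Prop :=
  (forall c, set c -> forall w, set w -> forall w', set w' ->
    pair_in c w f -> pair_in c w' f -> w = w') /\
  forall c, set c -> forall w, set w -> pair_in c w f ->
    c ∈ A /\ (forall d, set d -> d ∈ A -> d ∈ c -> exists w', set w' /\ pair_in d w' f) /\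
    is_value f c w.

Hypothesis (chain_A : chain A) (def_H : def4 H).
(** Makes each single contribution a set, so that Replacement and Union make the prescribed value a
    set. *)
Hypothesis bounded_H : forall b c w, set b -> set c -> set w ->
  exists h, set h /\ forall z, H b c w z -> z ∈ h.

Lemma def_is_value : def3 is_value.
Proof. intros t1 t2 t3 ? ? ?. unfold is_value. dfn. Qed.

Lemma def_attempt : def1 attempt.
Proof. pose proof def_is_value. intros t ?. unfold attempt. dfn. Qed.

Lemma attempt_value f b v : attempt f -> pair_in b v f -> is_value f b v.
Proof. intros [_ Hf] Hbv. destruct (pair_in_set _ _ _ Hbv). now apply Hf. Qed.

Lemma attempt_below f b v d : attempt f -> pair_in b v f -> d ∈ A -> d ∈ b ->
  exists w, pair_in d w f.
Proof.
  intros [_ Hf] Hbv HdA Hd. destruct (pair_in_set _ _ _ Hbv) as [Hb Hv].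
  destruct (Hf b Hb v Hv Hbv) as (_ & Hbelow & _).
  destruct (Hbelow d) as (w & _ & Hw); eauto using set_mem.
Qed.

Lemma attempt_unique f g b v v' : set f -> set g -> attempt f -> attempt g ->
  pair_in b v f -> pair_in b v' g -> v = v'.
Proof.
  intros Hf Hg Haf Hag Hbv Hbv'. apply NNPP. intros Hne.
  pose proof def_attempt.
  (* The point of disagreement is minimised over all pairs of attempts at once; below [b0] any two
     attempts agree. *)
  destruct (least (fun b => exists f, set f /\ exists g, set g /\ (attempt f /\ attempt g /\
    exists v, set v /\ exists v', set v' /\ (pair_in b v f /\ pair_in b v' g /\ v <> v'))))
    as (b0 & Hb0 & Hex & Hmin).
  { dfn. }
  { destruct (pair_in_set _ _ _ Hbv), (pair_in_set _ _ _ Hbv').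
    exists b. split; auto. exists f. split; auto. exists g. split; auto. split; auto. split; auto.
    exists v. split; auto. exists v'. auto. }
  assert (Hinc : forall f g v v', set f -> set g -> attempt f -> attempt g ->
    pair_in b0 v f -> pair_in b0 v' g -> forall z, z ∈ v -> z ∈ v').
  { clear - Hmin def_H. intros f g v v' Hf Hg Haf Hag Hv Hv' z Hz.
    assert (Hzs := set_mem _ _ Hz).
    apply (attempt_value f b0 v) in Hz; auto.
    apply (attempt_value g b0 v'); auto.
    destruct Hz as (c & Hc & HcA & Hcb & w & Hw & Hcw & HH).
    exists c. split; auto. split; auto. split; auto.
    destruct (attempt_below g b0 v' c Hag Hv' HcA Hcb) as (w' & Hcw').
    destruct (pair_in_set _ _ _ Hcw') as [_ Hw'].
    exists w'. split; auto. split; auto. replace w' with w; auto.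
    apply NNPP. intros Hne. apply (Hmin c Hcb).
    exists f. split; auto. exists g. split; auto. split; auto. split; auto.
    exists w. split; auto. exists w'. auto. }
  destruct Hex as (f1 & Hf1 & g1 & Hg1 & Haf1 & Hag1 & w & _ & w' & _ & Hw & Hw' & Hww).
  apply Hww, ext. intros z. split.
  - now apply (Hinc f1 g1).
  - now apply (Hinc g1 f1).
Qed.

Definition rec_graph (b v : M) : Prop := exists f, set f /\ (attempt f /\ pair_in b v f).

Lemma def_rec_graph : def2 rec_graph.
Proof. pose proof def_attempt. intros t1 t2 ? ?. unfold rec_graph. dfn. Qed.

Lemma rec_graph_unique b v v' : rec_graph b v -> rec_graph b v' -> v = v'.
Proof.
  intros (f & Hf & Haf & Hv) (g & Hg & Hag & Hv'). now apply (attempt_unique f g b).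
Qed.

Lemma rec_graph_set b v : rec_graph b v -> set b /\ set v.
Proof. intros (f & _ & _ & Hv). now apply pair_in_set in Hv. Qed.

Lemma rec_graph_in b v : rec_graph b v -> b ∈ A.
Proof.
  intros (f & _ & [_ Haf] & Hv). destruct (pair_in_set _ _ _ Hv). now apply (Haf b) with v.
Qed.

Lemma rec_graph_value b v : rec_graph b v ->
  forall z, z ∈ v <-> set z /\ exists c, c ∈ A /\ c ∈ b /\
    exists w, rec_graph c w /\ H b c w z.
Proof.
  intros (f & Hf & Haf & Hv) z. split.
  - intros Hz. split; [now apply set_mem in Hz|].
    apply (attempt_value f b v) in Hz; eauto using set_mem.
    destruct Hz as (c & Hc & HcA & Hcb & w & Hw & Hcw & HH).
    exists c. repeat split; auto. exists w. split; auto. exists f; auto.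
  - intros (Hz & c & HcA & Hcb & w & Hcw & HH).
    apply (attempt_value f b v); auto. exists c. split; [now apply set_mem in HcA|].
    split; auto. split; auto. exists w. destruct (rec_graph_set _ _ Hcw). split; auto.
    split; auto. destruct (attempt_below f b v c Haf Hv HcA Hcb) as (w' & Hw').
    replace w with w'; auto. apply (rec_graph_unique c); auto. exists f; auto.
Qed.

Lemma rec_graph_total b : set b -> b ∈ A -> exists v, rec_graph b v.
Proof.
  intros Hbs HbA. apply NNPP. intros Hno.
  pose proof def_rec_graph as Hdef. pose proof def_is_value.
  destruct (least (fun b => b ∈ A /\ ~ exists v, set v /\ rec_graph b v))
    as (b0 & Hb0 & [Hb0A Hnone] & Hmin).
  { dfn. }
  { exists b. split; auto. split; auto. intros (v & _ & Hv). eauto. }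
  clear b Hbs HbA Hno.
  assert (Hbelow : forall c, c ∈ A -> c ∈ b0 -> exists w, rec_graph c w).
  { intros c HcA Hc. apply NNPP. intros Hno. apply (Hmin c Hc). split; auto.
    intros (w & _ & Hw). eauto. }
  destruct chain_A as [Htrans Hlin].
  assert (Hv : exists v, set v /\ forall z, z ∈ v <-> set z /\ exists c, set c /\
    (c ∈ A /\ c ∈ b0 /\ exists w, set w /\ (rec_graph c w /\ H b0 c w z))).
  (* Replacement collects the contributions [h] of the earlier points; the value is carved out of
     their union. *)
  { destruct (replace_ex b0 (fun c h => exists w, set w /\ (rec_graph c w /\
      forall z, set z -> (z ∈ h <-> H b0 c w z)))) as (u & Hu & Hux); auto.
    - dfn.
    - intros c h h' Hc Hh Hh' (w & _ & Hw & Hz) (w' & _ & Hw' & Hz').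
      rewrite <- (rec_graph_unique _ _ _ Hw Hw') in Hz'. apply ext. intros z. split; intros Hin;
        assert (Hs := set_mem _ _ Hin).
      + now apply Hz', Hz.
      + now apply Hz, Hz'.
    - destruct (ax_union M mem HM u Hu) as (U & HU & HUz).
      assert (HdefP : def1 (fun z => exists c, set c /\
        (c ∈ A /\ c ∈ b0 /\ exists w, set w /\ (rec_graph c w /\ H b0 c w z)))) by dfn.
      destruct (sep U _ HU HdefP) as (v & Hvs & Hvz).
      exists v. split; auto. intros z. rewrite Hvz. split.
      + intros [Hz ?]. split; auto. now apply set_mem in Hz.
      + intros (Hzs & Hz). split; auto. apply HUz.
        destruct Hz as (c & Hc & HcA & Hcb & w & Hw & Hcw & HH).
        destruct (bounded_H b0 c w) as (h & Hh & Hhz); auto.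
        destruct (sep h (H b0 c w)) as (h' & Hh' & Hh'z); auto.
        { intros t Ht. apply def_H; auto using term_const. }
        exists h'. split; [apply Hh'z; auto|]. apply Hux. split; auto. exists c. split; auto.
        exists w. split; auto. split; auto. intros y Hy. rewrite Hh'z. split; [tauto|]. auto. }
  destruct Hv as (v & Hv & Hvz).
  destruct (adjoin_ex b0 b0) as (b1 & Hb1 & Hb1z); auto.
  (* The known values below [b0], extended by [v] at [b0], form an attempt, against the choice of
     [b0]. *)
  destruct (function_ex b1 (fun c w => c ∈ A /\ ((c ∈ b0 /\ rec_graph c w) \/ (c = b0 /\ w = v))))
    as (f & Hf & Hfx & _); auto.
  { dfn. }
  { intros c w w' _ _ _ (_ & [[Hc Hw]|[-> ->]]) (_ & [[Hc' Hw']|[Hc' Hw']]); subst; auto.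
    - eapply rec_graph_unique; eauto.
    - now destruct (no_loop1 b0).
    - now destruct (no_loop1 b0). }
  assert (Hfb : forall c w, c ∈ b0 -> (pair_in c w f <-> rec_graph c w)).
  { intros c w Hc. rewrite Hfx, Hb1z. split.
    - intros (_ & _ & _ & [[_ Hw]|[-> _]]); auto. now destruct (no_loop1 b0).
    - intros Hw. destruct (rec_graph_set _ _ Hw). apply rec_graph_in in Hw as HcA. auto 6. }
  assert (Hfv : pair_in b0 v f) by (apply Hfx; rewrite Hb1z; auto 6).
  apply Hnone. exists v. split; auto. exists f. split; auto. split; auto. split.
  { intros c _ w _ w' _ Hw Hw'. apply Hfx in Hw as (_ & _ & HcA & Hw), Hw' as (_ & _ & _ & Hw').
    destruct Hw as [[Hc Hw]|[-> ->]], Hw' as [[Hc' Hw']|[Hc' Hw']]; subst; auto.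
    - eapply rec_graph_unique; eauto.
    - now destruct (no_loop1 b0).
    - now destruct (no_loop1 b0). }
  intros c Hc w Hw Hcw. apply Hfx in Hcw as (_ & _ & HcA & [[Hcb Hcw]|[-> ->]]).
  - assert (Hsub : forall d, d ∈ A -> d ∈ c -> d ∈ b0) by (intros d ? ?; apply (Htrans d c b0); auto).
    split; auto. split.
    + intros d Hd HdA Hdc. destruct (Hbelow d HdA) as (w' & Hw'); auto.
      destruct (rec_graph_set _ _ Hw'). exists w'. split; auto. apply Hfb; auto.
    + intros z Hz. rewrite (rec_graph_value c w Hcw). split.
      * intros (_ & d & HdA & Hdc & w' & Hw' & HH). destruct (rec_graph_set _ _ Hw').
        exists d. split; auto. split; auto. split; auto. exists w'. split; auto. split; auto. apply Hfb; auto.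
      * intros (d & Hd & HdA & Hdc & w' & Hw's & Hw' & HH). split; auto.
        exists d. repeat split; auto. exists w'. split; auto. apply Hfb; auto.
  - split; auto. split.
    + intros d Hd HdA Hdb. destruct (Hbelow d HdA) as (w' & Hw'); auto.
      destruct (rec_graph_set _ _ Hw'). exists w'. split; auto. apply Hfb; auto.
    + intros z Hz. rewrite Hvz. split.
      * intros (_ & d & Hd & HdA & Hdb & w' & Hw's & Hw' & HH).
        exists d. split; auto. split; auto. split; auto. exists w'. split; auto. split; auto. apply Hfb; auto.
      * intros (d & Hd & HdA & Hdb & w' & Hw's & Hw' & HH). split; auto.
        exists d. split; auto. split; auto. split; auto. exists w'. split; auto. split; auto. apply Hfb; auto.
Qed.

Theorem recursion : exists F,
  functional F /\
  (forall b v, pair_in b v F -> b ∈ A) /\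
  (forall b, b ∈ A -> exists v, pair_in b v F) /\
  forall b v, pair_in b v F -> forall z, z ∈ v <-> set z /\ exists c, c ∈ A /\ c ∈ b /\
    exists w, pair_in c w F /\ H b c w z.
Proof.
  destruct (relation_of rec_graph def_rec_graph) as (F & HF).
  assert (HF' : forall b v, pair_in b v F <-> rec_graph b v).
  { intros b v. rewrite HF. split; [tauto|]. intros Hbv. destruct (rec_graph_set _ _ Hbv). auto. }
  exists F. split; [|split; [|split]].
  - intros b v v' Hv Hv'. apply HF' in Hv, Hv'. eapply rec_graph_unique; eauto.
  - intros b v Hv. apply HF' in Hv. now apply rec_graph_in in Hv.
  - intros b Hb. destruct (rec_graph_total b) as (v & Hv); eauto using set_mem.
    exists v. now apply HF'.
  - intros b v Hv z. apply HF' in Hv. rewrite (rec_graph_value b v Hv).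
    split; intros (Hz & c & HcA & Hcb & w & Hw & HH); split; auto; exists c;
      repeat split; auto; exists w; split; auto; now apply HF'.
Qed.

End Recursion.

(** * Splitting non-small classes *)

Definition injective_class (F : M) : Prop :=
  forall x x' y, pair_in x y F -> pair_in x' y F -> x = x'.

(* The parity of an element of [A] is found by recursion: [x] is odd iff it is
   the immediate successor in [A] of an even element. *)
Lemma chain_parity A : chain A -> exists E O F,
  (forall x, x ∈ A <-> x ∈ E \/ x ∈ O) /\ (forall x, x ∈ E -> ~ x ∈ O) /\
  functional F /\ injective_class F /\
  (forall x y, pair_in x y F -> x ∈ E /\ y ∈ O) /\
  (forall y, y ∈ O -> exists x, pair_in x y F) /\
  forall x x', x ∈ E -> x' ∈ E ->
    (~ exists y, pair_in x y F) -> (~ exists y, pair_in x' y F) -> x = x'.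
Proof.
  intros HA. destruct empty_ex as (o & Ho & Hoz).
  set (pred_of := fun c b => c ∈ b /\ forall d, set d -> d ∈ A -> c ∈ d -> ~ d ∈ b).
  assert (Hpred : def2 pred_of) by (unfold pred_of; dfn).
  (* The empty set [o] codes even. The value at [b] is [{o}] if [b] immediately succeeds an even
     element and [o] otherwise, so elements without immediate predecessor are even. *)
  destruct (recursion A (fun b c w z => z = o /\ w = o /\ pred_of c b))
    as (V & HVf & HVA & HVt & HVv); auto.
  { dfn. }
  { intros b c w _ _ _. destruct (pair_ex o o) as (h & Hh & Hhz); auto.
    exists h. split; auto. intros z (-> & _). apply Hhz; auto. }
  destruct (class_of (fun b => pair_in b o V)) as (E & HE); [dfn|].
  destruct (class_of (fun b => b ∈ A /\ ~ pair_in b o V)) as (O & HO); [dfn|].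
  destruct (relation_of (fun c b => c ∈ E /\ b ∈ A /\ pred_of c b)) as (F & HF); [dfn|].
  destruct HA as [Htrans Hlin].
  assert (HEo : forall x, x ∈ E -> x ∈ A /\ pair_in x o V).
  { intros x Hx. apply HE in Hx as [_ Hx]. eauto. }
  assert (HFO : forall x y, pair_in x y F -> y ∈ O).
  { intros x y Hxy. apply HF in Hxy as (_ & Hy & HxE & HyA & Hp).
    apply HO. split; auto. split; auto. intros Hyo.
    apply (Hoz o), (HVv y o Hyo). split; auto.
    destruct (HEo x HxE) as [HxA Hxo].
    exists x. split; auto. split; [apply Hp|]. exists o. auto. }
  assert (Hpred_lt : forall x y y', x ∈ A -> y ∈ A -> y' ∈ A ->
    pred_of x y -> pred_of x y' -> ~ y ∈ y').
  { intros x y y' Hx Hy Hy' [Hxy _] [_ Hno]. apply Hno; auto. now apply set_mem in Hy. }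
  exists E, O, F. split; [|split; [|split; [|split; [|split; [|split]]]]].
  - intros x. rewrite HE, HO. split.
    + intros Hx. destruct (classic (pair_in x o V)); [left|right]; eauto using set_mem.
    + intros [[_ Hx]|[_ [Hx _]]]; eauto.
  - intros x Hx Hx'. apply HE in Hx as [_ Hx]. apply HO in Hx'. tauto.
  - intros x y y' Hy Hy'. apply HF in Hy as (_ & _ & HxE & HyA & Hp), Hy' as (_ & _ & _ & HyA' & Hp').
    destruct (HEo x HxE) as [HxA _].
    destruct (Hlin y y') as [Hlt|[Heq|Hlt]]; auto; exfalso; revert Hlt;
      [apply (Hpred_lt x y y')|apply (Hpred_lt x y' y)]; auto.
  - intros x x' y Hx Hx'. apply HF in Hx as (_ & _ & HxE & HyA & Hp), Hx' as (_ & _ & HxE' & _ & Hp').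
    destruct (HEo x HxE) as [HxA _], (HEo x' HxE') as [HxA' _].
    destruct (Hlin x x') as [Hlt|[Heq|Hlt]]; auto; exfalso.
    + destruct Hp as [_ Hno]. apply (Hno x'); auto; [eauto using set_mem|apply Hp'].
    + destruct Hp' as [_ Hno]. apply (Hno x); auto; [eauto using set_mem|apply Hp].
  - intros x y Hxy. split; eauto. apply HF in Hxy. tauto.
  - intros y Hy. apply HO in Hy as (Hys & HyA & Hyo).
    destruct (HVt y HyA) as (v & Hv).
    assert (Hz : exists z, z ∈ v).
    { apply NNPP. intros Hno. apply Hyo. replace o with v; auto. apply ext. intros z.
      split; intros Hz; exfalso; [eauto|now apply Hoz in Hz]. }
    destruct Hz as (z & Hz). apply (HVv y v Hv) in Hz as (_ & c & HcA & Hcy & w & Hw & _ & -> & Hp).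
    assert (set c) by eauto using set_mem.
    exists c. apply HF. split; auto. split; auto. split; auto. apply HE. auto.
  - intros x x' HxE HxE' Hno Hno'.
    destruct (HEo x HxE) as [HxA _], (HEo x' HxE') as [HxA' _].
    (* An even element that is not the last one has a least element of [A] above it, which is its
       successor; only the last element can be missed by [F]. *)
    assert (Hnext : forall x x', x ∈ A -> x' ∈ A -> x ∈ E -> x ∈ x' -> exists y, pair_in x y F).
    { clear - HM HF Hlin. intros x x' HxA HxA' HxE Hxx.
      destruct (least (fun y => y ∈ A /\ x ∈ y)) as (y & Hy & [HyA Hxy] & Hmin).
      - dfn.
      - exists x'. split; eauto using set_mem.
      - exists y. apply HF. split; [eauto using set_mem|]. split; auto. split; auto. split; auto.
        split; auto. intros d Hd HdA Hxd Hdy. now apply (Hmin d). }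
    destruct (Hlin x x') as [Hlt|[Heq|Hlt]]; auto; exfalso; eauto.
Qed.

(** [sm_image] lets smallness pass along the successor map between the halves of a chain;
    [sm_single] and [sm_union] absorb the one element without successor. *)
Record small_ideal (Small : M -> Prop) : Prop := {
  sm_sub : forall x y, x ⊆ y -> Small y -> Small x;
  sm_union : forall x y u, Small x -> Small y ->
    (forall z, z ∈ u <-> z ∈ x \/ z ∈ y) -> Small u;
  sm_single : forall a s, set a -> (forall z, z ∈ s <-> z = a) -> Small s;
  sm_image : forall x y F, Small x -> functional F -> injective_class F ->
    (forall z, z ∈ y <-> exists z', z' ∈ x /\ pair_in z' z F) -> Small y
}.

Definition splits (Small : M -> Prop) (A : M) : Prop :=
  exists B, B ⊆ A /\ ~ Small B /\
    forall C, (forall z, z ∈ C <-> z ∈ A /\ ~ z ∈ B) -> ~ Small C.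

Lemma chain_splits Small A : small_ideal Small -> chain A -> ~ Small A -> splits Small A.
Proof.
  intros HS HA HnA.
  destruct (chain_parity A HA) as (E & O & F & HEO & Hdis & Hfun & Hinj & HF & Honto & Hlast).
  assert (Hswap : Small E -> Small O).
  { intros HE. apply (sm_image _ HS E O F); auto. intros y. split.
    - intros Hy. destruct (Honto y Hy) as (x & Hx). exists x. split; auto. now apply HF in Hx.
    - intros (x & _ & Hx). now apply HF in Hx. }
  assert (Hback : Small O -> Small E).
  { intros HO. destruct (relation_of (fun y x => pair_in x y F)) as (G & HG); [dfn|].
    destruct (class_of (fun x => exists y, set y /\ pair_in x y F)) as (E1 & HE1); [dfn|].
    assert (HsE1 : Small E1).
    { apply (sm_image _ HS O E1 G); auto.
      - intros x y y' Hy Hy'. apply HG in Hy, Hy'. eapply Hinj; [apply Hy|apply Hy'].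
      - intros x x' y Hx Hx'. apply HG in Hx, Hx'. eapply Hfun; [apply Hx|apply Hx'].
      - intros x. rewrite HE1. split.
        + intros (Hx & y & Hy & Hxy). exists y. split; [now apply HF in Hxy|]. apply HG; auto.
        + intros (y & _ & Hxy). apply HG in Hxy as (Hy & Hx & Hxy). eauto. }
    (* [E] is the domain [E1] of the successor map plus at most one further element. *)
    destruct (classic (exists a, a ∈ E /\ ~ exists y, pair_in a y F)) as [(a & Ha & Hmax)|Hno].
    - destruct (pair_ex a a) as (s & Hs & Hsz); eauto using set_mem.
      apply (sm_sub _ HS E E); [now intros z|].
      destruct (class_of (fun z => z ∈ E1 \/ z ∈ s)) as (U & HU); [dfn|].
      apply (sm_sub _ HS E U).
      + intros z Hz. apply HU. split; eauto using set_mem.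
        destruct (classic (exists y, pair_in z y F)) as [(y & Hy)|Hzmax].
        * left. apply HE1. destruct (pair_in_set _ _ _ Hy). eauto.
        * right. apply Hsz. left. eapply Hlast; eauto.
      + apply (sm_union _ HS E1 s); auto.
        * apply (sm_single _ HS a); eauto using set_mem. intros z. rewrite Hsz. tauto.
        * intros z. rewrite HU. split; [tauto|]. intros Hz. split; auto.
          destruct Hz; eauto using set_mem.
    - apply (sm_sub _ HS E E1); auto. intros z Hz. apply HE1. split; eauto using set_mem.
      apply NNPP. intros Hn. apply Hno. exists z. split; auto. intros (y & Hy). apply Hn.
      destruct (pair_in_set _ _ _ Hy). eauto. }
  assert (HnE : ~ Small E).
  { intros HE. apply HnA. apply (sm_union _ HS E O); auto. }
  exists E. split; [|split; auto].
  - intros z Hz. apply HEO; auto.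
  - intros C HC HsC. apply HnE, Hback. apply (sm_sub _ HS O C); auto.
    intros z Hz. apply HC. rewrite HEO. split; auto. intros Hz'. now apply (Hdis z).
Qed.

Lemma chain_sub A B : B ⊆ A -> chain A -> chain B.
Proof.
  intros HBA [Htrans Hlin]. split.
  - intros x y z Hx Hy Hz. apply Htrans; auto.
  - intros x y Hx Hy. apply Hlin; auto.
Qed.

(** The usual proof that ordinals are comparable, abstracted so that it also serves the levels of
    the hierarchy. The second hypothesis says that a member of [W] is determined by the members of
    [W] it contains. *)
Lemma transitive_chain W :
  (forall s y z, s ∈ W -> z ∈ y -> y ∈ s -> z ∈ s) ->
  (forall s t, s ∈ W -> t ∈ W -> (forall r, r ∈ W -> r ∈ s -> r ∈ t) ->
    (forall r, r ∈ W -> r ∈ t -> r ∈ s) -> s = t) ->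
  chain W.
Proof.
  intros Htrans Hext. split; [intros x y z _ _ Hz Hxy Hyz; eauto|].
  set (comparable := fun x y => x ∈ y \/ x = y \/ y ∈ x).
  assert (Hcomp : def2 comparable) by (unfold comparable; dfn).
  intros x y Hx Hy. change (comparable x y). apply NNPP. intros Hn.
  (* With [s] minimal among those incomparable to something, and then [t] minimal among those
     incomparable to [s], the two contain the same members of [W]. *)
  destruct (least (fun s => s ∈ W /\ exists t, set t /\ (t ∈ W /\ ~ comparable s t)))
    as (s & _ & (HsW & Hbad) & Hmins).
  { dfn. }
  { exists x. split; [eauto using set_mem|]. split; auto. exists y. eauto using set_mem. }
  destruct (least (fun t => t ∈ W /\ ~ comparable s t)) as (t & _ & (HtW & Hst) & Hmint); auto.
  { dfn. }
  apply Hst. right; left. apply Hext; auto.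
  - intros r HrW Hrs. assert (Hrt : comparable r t).
    { apply NNPP. intros Hrt. apply (Hmins r Hrs). split; auto. exists t. eauto using set_mem. }
    destruct Hrt as [Hrt|[->|Htr]]; auto; exfalso; apply Hst; right; right; eauto.
  - intros r HrW Hrt. assert (Hsr : comparable s r).
    { apply NNPP. intros Hsr. apply (Hmint r Hrt). auto. }
    destruct Hsr as [Hsr|[->|Hrs]]; auto; exfalso; apply Hst; left; eauto.
Qed.

(** * The cumulative hierarchy as a class of levels *)

(* Levels are the stages V_a, presented without ordinals: a history is a set each
   of whose elements consists of the subsets of its earlier elements. *)
Definition history (h : M) : Prop :=
  forall a, set a -> a ∈ h -> forall x, set x ->
    (x ∈ a <-> exists c, set c /\ (c ∈ h /\ c ∈ a /\ x ⊆ c)).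

(** In the style of Scott and Potter. Since a history is a set, being a level is predicative from
    the outset. *)
Definition level (s : M) : Prop :=
  set s /\ exists h, set h /\ (history h /\ forall x, set x ->
    (x ∈ s <-> exists c, set c /\ (c ∈ h /\ x ⊆ c))).

Lemma def_level : def1 level.
Proof. intros t Ht. unfold level, history. dfn. Qed.

(** If [y] is included in an earlier [c], then [z] is an element of [c]; by induction [c] is
    transitive, so [z] is also a subset of [c] and hence an element of [a]. *)
Lemma history_elem_trans h a y z : set h -> history h -> a ∈ h -> z ∈ y -> y ∈ a -> z ∈ a.
Proof.
  intros Hh Hhist Ha. revert a Ha y z.
  assert (Hall : forall a, set a -> a ∈ h -> forall y, set y -> forall z, set z ->
    z ∈ y -> y ∈ a -> z ∈ a).
  { apply (mem_induction (fun a => a ∈ h -> forall y, set y -> forall z, set z ->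
      z ∈ y -> y ∈ a -> z ∈ a)); [dfn|].
    intros a Has IH Hah y Hy z Hz Hzy Hya.
    apply (Hhist a Has Hah y Hy) in Hya as (c & Hc & Hch & Hca & Hyc).
    apply (Hhist a Has Hah z Hz). exists c. split; auto. split; auto. split; auto.
    intros w Hw. apply (IH c Hca Hch z Hz w); eauto using set_mem. }
  intros a Ha y z Hzy Hya. apply (Hall a) with y; eauto using set_mem.
Qed.

Lemma level_trans s y z : level s -> z ∈ y -> y ∈ s -> z ∈ s.
Proof.
  intros (Hs & h & Hh & Hhist & Hx) Hzy Hys.
  apply Hx in Hys as (c & Hc & Hch & Hyc); eauto using set_mem.
  apply Hx; eauto using set_mem. exists c. split; auto. split; auto.
  intros w Hw. apply (history_elem_trans h c z w); auto.
Qed.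

Lemma history_elem_level h a : set h -> history h -> a ∈ h -> level a.
Proof.
  intros Hh Hhist Ha. assert (Has := set_mem _ _ Ha). split; auto.
  destruct (sep h (fun c => c ∈ a)) as (h' & Hh' & Hc'); auto; [dfn|].
  exists h'. split; auto. split.
  - intros b Hb Hbh x Hx. apply Hc' in Hbh as [Hbh Hba]. rewrite (Hhist b Hb Hbh x Hx).
    split; intros (c & Hc & Hch & Hcb & Hxc); exists c; split; auto; split; auto.
    + apply Hc'. split; auto. apply (history_elem_trans h a b c); auto.
    + now apply Hc' in Hch.
  - intros x Hx. rewrite (Hhist a Has Ha x Hx).
    split; intros (c & Hc & Hch & Hxc); exists c; split; auto.
    + split; [|tauto]. apply Hc'. tauto.
    + apply Hc' in Hch. tauto.
Qed.

(** With the history eliminated, a level is seen to be determined by the levels in it, as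
    [transitive_chain] requires. *)
Lemma level_char s x : level s -> (x ∈ s <-> exists r, level r /\ r ∈ s /\ x ⊆ r).
Proof.
  intros (Hs & h & Hh & Hhist & Hx). split.
  - intros Hxs. apply Hx in Hxs as (c & Hc & Hch & Hxc); eauto using set_mem.
    exists c. split; [apply (history_elem_level h c); auto|]. split; auto.
    apply Hx; auto. exists c. split; auto. split; auto. now intros z.
  - intros (r & _ & Hr & Hxr). assert (Hrs := set_mem _ _ Hr).
    apply Hx in Hr as (c & Hc & Hch & Hrc); auto.
    apply Hx; [now apply (set_sub x r)|]. exists c. split; auto. split; auto.
    intros z Hz. auto.
Qed.

Lemma levels_chain L : (forall x, x ∈ L <-> set x /\ level x) -> chain L.
Proof.
  intros HL. apply transitive_chain.
  - intros s y z Hs. apply HL in Hs as [_ Hs]. now apply level_trans.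
  - intros s t Hs Ht Hst Hts. apply HL in Hs as [_ Hs], Ht as [_ Ht].
    apply ext. intros x. rewrite (level_char s x Hs), (level_char t x Ht).
    split; intros (r & Hr & Hin & Hx); exists r; split; auto; split; auto.
    + apply Hst; auto. apply HL. eauto using set_mem.
    + apply Hts; auto. apply HL. eauto using set_mem.
Qed.

(** The members of [L] and the levels inside them form a history; each [l] belongs to its level
    because [l] is a subset of itself. *)
Lemma level_above L : set L -> (forall l, l ∈ L -> level l) ->
  exists s, level s /\ forall l, l ∈ L -> l ∈ s.
Proof.
  intros HL Hlev. pose proof def_level.
  destruct (ax_union M mem HM L HL) as (U & HU & HUz).
  destruct (union_ex L U HL HU) as (W & HW & HWz).
  destruct (sep W level) as (h & Hh & Hhz); auto.
  destruct (ax_union M mem HM h Hh) as (U' & HU' & HU'z).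
  destruct (ax_power M mem HM U' HU') as (P & HP & HPz).
  destruct (sep P (fun x => exists c, set c /\ (c ∈ h /\ x ⊆ c))) as (s & Hs & Hsz); auto.
  { dfn. }
  exists s. split.
  - split; auto. exists h. split; auto. split.
    + intros a Ha Hah x Hx. apply Hhz in Hah as [Hah Hla].
      rewrite (level_char a x Hla). split.
      * intros (r & Hr & Hra & Hxr). exists r. split; [now apply set_mem in Hra|].
        split; auto. apply Hhz. split; auto. apply HWz. right. apply HUz.
        apply HWz in Hah as [Hah|Hah]; [eauto|].
        apply HUz in Hah as (l & Hal & HlL). exists l. split; auto.
        apply (level_trans l a); auto.
      * intros (c & _ & Hch & Hca & Hxc). exists c. split; auto. now apply Hhz in Hch.
    + intros x Hx. rewrite Hsz. split; [tauto|]. intros (c & Hc & Hch & Hxc).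
      split; eauto. apply HPz. split; auto. intros z Hz. apply HU'z. eauto.
  - intros l Hl. assert (Hls := set_mem _ _ Hl).
    assert (Hlh : l ∈ h) by (apply Hhz; split; auto; apply HWz; auto).
    apply Hsz. split.
    + apply HPz. split; auto. intros z Hz. apply HU'z. eauto.
    + exists l. split; auto. split; auto. now intros z.
Qed.

(** The first level with [x] as an element, that is, the stage following the usual rank of [x]. *)
Definition rank (x l : M) : Prop :=
  level l /\ x ∈ l /\ forall r, set r -> level r -> r ∈ l -> ~ x ∈ r.

Lemma def_rank : def2 rank.
Proof. pose proof def_level. intros t s Ht Hs. unfold rank. dfn. Qed.

Lemma rank_unique x l l' : rank x l -> rank x l' -> l = l'.
Proof.
  intros (Hl & Hx & Hmin) (Hl' & Hx' & Hmin').
  assert (Hls := proj1 Hl). assert (Hls' := proj1 Hl').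
  destruct (class_of level def_level) as (L & HL).
  destruct (levels_chain L HL) as [_ Hlin].
  destruct (Hlin l l') as [Hlt|[Heq|Hlt]]; auto; try (apply HL; auto); exfalso.
  - now apply (Hmin' l).
  - now apply (Hmin l').
Qed.

Lemma rank_ex_of_level x l : level l -> x ∈ l -> exists r, rank x r.
Proof.
  intros Hl Hx. pose proof def_level.
  destruct (least (fun l => level l /\ x ∈ l)) as (r & Hr & [Hlev Hxr] & Hmin).
  - dfn.
  - exists l. split; [apply Hl|auto].
  - exists r. split; auto. split; auto. intros q _ Hq Hqr Hxq. now apply (Hmin q).
Qed.

Lemma rank_total x : set x -> exists l, rank x l.
Proof.
  intros Hx. pose proof def_level. pose proof def_rank.
  assert (Hlev : exists l, set l /\ (level l /\ x ∈ l)).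
  { revert x Hx. apply (mem_induction (fun x => exists l, set l /\ (level l /\ x ∈ l))); [dfn|].
    intros x Hx IH.
    (* Some level contains each element of [x], but only the least such level is unique and can be
       collected by Replacement. *)
    destruct (replace_ex x rank) as (L & HL & HLz); auto.
    { intros y l l' _ _ _. apply rank_unique. }
    destruct (level_above L HL) as (s & Hs & HLs).
    { intros l Hl. apply HLz in Hl as (_ & y & _ & Hl & _). auto. }
    assert (Hss := proj1 Hs).
    destruct (pair_ex s s Hss Hss) as (p & Hp & Hpz).
    destruct (level_above p Hp) as (s' & Hs' & Hps').
    { intros l Hl. apply Hpz in Hl as [-> | ->]; auto. }
    exists s'. split; [apply Hs'|]. split; auto. apply (level_char s' x Hs').
    exists s. split; auto. split; [apply Hps', Hpz; auto|].
    intros y Hy. destruct (IH y Hy) as (l & _ & Hl & Hyl).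
    destruct (rank_ex_of_level y l Hl Hyl) as (r & Hr).
    apply (level_trans s r y); auto; [apply Hr|]. apply HLs, HLz. split; [apply Hr|eauto]. }
  destruct Hlev as (l & _ & Hl & Hxl). eapply rank_ex_of_level; eauto.
Qed.

Lemma set_small_ideal : small_ideal set.
Proof.
  split.
  - intros x y Hxy Hy. now apply (set_sub x y).
  - intros x y u Hx Hy Hu. destruct (union_ex x y Hx Hy) as (v & Hv & Hvz).
    apply (set_sub u v); auto. intros z Hz. apply Hvz, Hu, Hz.
  - intros a s Ha Hs. destruct (pair_ex a a Ha Ha) as (p & Hp & Hpz).
    apply (set_sub s p); auto. intros z Hz. apply Hpz. left. now apply Hs.
  - intros x y F Hx HF _ Hy. destruct (ax_repl M mem HM F x HF Hx) as (b & Hb & Hbz).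
    apply (set_sub y b); auto. intros z Hz. now apply Hbz, Hy.
Qed.

(** The ranks of elements of [A] form a proper class, since their union covers [A]. This chain is
    split by parity and the cut is pulled back; each piece of [A] maps onto its half of the ranks,
    so neither is a set. *)
Lemma proper_splits A : ~ set A -> splits set A.
Proof.
  intros HA. pose proof def_level. pose proof def_rank.
  destruct (class_of (fun l => exists x, set x /\ (x ∈ A /\ rank x l))) as (R & HR); [dfn|].
  destruct (class_of level def_level) as (L & HL).
  assert (HRc : chain R).
  { apply (chain_sub L); [|now apply levels_chain].
    intros l Hl. apply HL. apply HR in Hl as (Hls & x & _ & _ & Hl & _). auto. }
  assert (HRA : forall x, x ∈ A -> exists l, l ∈ R /\ rank x l).
  { intros x Hx. assert (Hxs := set_mem _ _ Hx). destruct (rank_total x Hxs) as (l & Hl).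
    exists l. split; auto. apply HR. split; [apply Hl|]. eauto. }
  assert (HnR : ~ set R).
  { intros HRs. apply HA. destruct (ax_union M mem HM R HRs) as (U & HU & HUz).
    apply (set_sub A U); auto. intros x Hx. destruct (HRA x Hx) as (l & Hl & Hr).
    apply HUz. exists l. split; auto. apply Hr. }
  assert (Himage : forall B C, set B -> (forall l, l ∈ C -> exists x, x ∈ B /\ rank x l) -> set C).
  { intros B C HB HC. destruct (replace_ex B rank) as (D & HD & HDz); auto.
    - intros x l l' _ _ _. apply rank_unique.
    - apply (set_sub C D); auto. intros l Hl. apply HDz. split; eauto using set_mem. }
  destruct (chain_splits set R set_small_ideal HRc HnR) as (B & HBR & HnB & HnC).
  destruct (class_of (fun x => x ∈ A /\ exists l, set l /\ (l ∈ B /\ rank x l))) as (B' & HB'); [dfn|].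
  exists B'. split; [|split].
  - intros x Hx. now apply HB' in Hx.
  - intros HB's. apply HnB. apply (Himage B'); auto. intros l Hl.
    assert (HlR := HBR l Hl). apply HR in HlR as (Hls & x & Hx & HxA & Hr).
    exists x. split; auto. apply HB'. split; auto. split; auto. eauto.
  - intros C' HC' HC's.
    destruct (class_of (fun l => l ∈ R /\ ~ l ∈ B)) as (C & HC); [dfn|].
    apply (HnC C).
    + intros l. rewrite HC. split; [tauto|]. intros [Hl ?]. eauto using set_mem.
    + apply (Himage C'); auto. intros l Hl. apply HC in Hl as (Hls & HlR & HlB).
      apply HR in HlR as (_ & x & Hx & HxA & Hr). exists x. split; auto. apply HC'. split; auto.
      intros HxB. apply HB' in HxB as (_ & _ & l' & _ & Hl' & Hr'). apply HlB.
      now rewrite (rank_unique x l l').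
Qed.

(** * Ordinals *)

Lemma def_ordinal : def1 ordinal.
Proof.
  intros t Ht. apply (definable_iff (fun e => set (t e) /\
    (forall x, set x -> forall y, set y -> x ∈ t e -> y ∈ x -> y ∈ t e) /\
    (forall x, set x -> forall y, set y -> x ∈ t e -> y ∈ t e -> x ∈ y \/ x = y \/ y ∈ x))).
  - intros e. split; intros (Hs & Htr & Hlin); (split; [auto|split]); eauto 6 using set_mem.
  - dfn.
Qed.

Lemma ordinal_trans a x y : ordinal a -> y ∈ x -> x ∈ a -> y ∈ a.
Proof. intros (_ & Htr & _) Hy Hx. eauto. Qed.

Lemma ordinal_elem a x : ordinal a -> x ∈ a -> ordinal x.
Proof.
  intros (Ha & Htr & Hlin) Hx. split; [eauto using set_mem|split].
  - intros y z Hy Hz. destruct (Hlin z x) as [H|[->|H]]; auto; [eauto| |].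
    + now destruct (no_loop2 x y).
    + now destruct (no_loop3 z y x).
  - intros y z Hy Hz. apply Hlin; eauto.
Qed.

Lemma ordinals_chain ON : (forall x, x ∈ ON <-> set x /\ ordinal x) -> chain ON.
Proof.
  intros HON. apply transitive_chain.
  - intros s y z Hs Hz Hy. apply HON in Hs as [_ Hs]. eapply ordinal_trans; eauto.
  - intros s t Hs Ht Hst Hts. apply HON in Hs as [_ Hs], Ht as [_ Ht]. apply ext. intros z.
    split; intros Hz.
    + apply Hst; auto. apply HON. split; eauto using set_mem, ordinal_elem.
    + apply Hts; auto. apply HON. split; eauto using set_mem, ordinal_elem.
Qed.

Lemma ordinal_compare a b : ordinal a -> ordinal b -> a ∈ b \/ a = b \/ b ∈ a.
Proof.
  intros Ha Hb. destruct (class_of ordinal def_ordinal) as (ON & HON).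
  apply (ordinals_chain ON HON); apply HON; split; auto; [apply Ha|apply Hb].
Qed.

Lemma ordinal_sub a b : ordinal a -> ordinal b -> a ⊆ b -> a ∈ b \/ a = b.
Proof.
  intros Ha Hb Hab. destruct (ordinal_compare a b) as [H|[H|H]]; auto.
  now destruct (no_loop1 b); auto.
Qed.

Lemma ordinal_chain a : ordinal a -> chain a.
Proof.
  intros Ha. split.
  - intros x y z _ _ Hz Hxy Hyz. apply (ordinal_elem a z) in Hz; auto.
    eapply ordinal_trans; eauto.
  - apply Ha.
Qed.

Lemma ordinal_intro a : set a -> (forall x y, x ∈ a -> y ∈ x -> y ∈ a) ->
  (forall x, x ∈ a -> ordinal x) -> ordinal a.
Proof.
  intros Ha Htr Hord. split; auto. split; auto.
  intros x y Hx Hy. apply ordinal_compare; auto.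
Qed.

Definition succ_of (a s : M) : Prop := forall z, z ∈ s <-> z ∈ a \/ z = a.

Definition set_succ (a s : M) : Prop := set a /\ succ_of a s.

Lemma def_set_succ : def2 set_succ.
Proof.
  intros a s Ha Hs. apply (definable_iff (fun e => set (a e) /\
    forall z, set z -> (z ∈ s e <-> z ∈ a e \/ z = a e))).
  - intros e. split; intros [Hae H]; (split; [auto|]); [|intros z _; apply H].
    intros z. split.
    + intros Hz. apply H; eauto using set_mem.
    + intros [Hz| ->]; apply H; eauto using set_mem.
  - dfn.
Qed.

Lemma succ_ex a : set a -> exists s, set s /\ succ_of a s.
Proof. intros Ha. now apply adjoin_ex. Qed.

Lemma succ_self a s : succ_of a s -> a ∈ s.
Proof. intros Hs. apply Hs. auto. Qed.

Lemma succ_unique a s s' : succ_of a s -> succ_of a s' -> s = s'.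
Proof. intros Hs Hs'. apply ext. intros z. now rewrite (Hs z), (Hs' z). Qed.

Lemma succ_inj a a' s : succ_of a s -> succ_of a' s -> a = a'.
Proof.
  intros Ha Ha'. assert (Hin := succ_self _ _ Ha). assert (Hin' := succ_self _ _ Ha').
  apply Ha' in Hin as [Hin|]; auto. apply Ha in Hin' as [Hin'|]; auto.
  now destruct (no_loop2 a a').
Qed.

Lemma succ_set a s : set a -> succ_of a s -> set s.
Proof.
  intros Ha Hs. destruct (succ_ex a Ha) as (s' & Hs' & Hsucc).
  now rewrite (succ_unique _ _ _ Hs Hsucc).
Qed.

Lemma ordinal_succ a s : ordinal a -> succ_of a s -> ordinal s.
Proof.
  intros Ha Hs. apply ordinal_intro.
  - apply (succ_set a); auto. apply Ha.
  - intros x y Hx Hy. apply Hs. left. apply Hs in Hx as [Hx| ->]; auto.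
    eapply ordinal_trans; eauto.
  - intros x Hx. apply Hs in Hx as [Hx| ->]; auto. eapply ordinal_elem; eauto.
Qed.

Lemma succ_le a b s : ordinal b -> a ∈ b -> succ_of a s -> s ∈ b \/ s = b.
Proof.
  intros Hb Hab Hs. apply ordinal_sub; auto.
  - apply (ordinal_succ a); auto. eapply ordinal_elem; eauto.
  - intros z Hz. apply Hs in Hz as [Hz| ->]; auto. eapply ordinal_trans; eauto.
Qed.

(* Zero counts as a limit here. *)
Definition limit (l : M) : Prop :=
  ordinal l /\ forall a s, a ∈ l -> succ_of a s -> s ∈ l.

Lemma def_limit : def1 limit.
Proof.
  intros t Ht. apply (definable_iff (fun e => ordinal (t e) /\
    forall a, set a -> forall s, set s -> a ∈ t e -> set_succ a s -> s ∈ t e)).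
  - intros e. split; intros [Ho Hl]; split; auto.
    + intros a s Ha Hs. assert (set a) by eauto using set_mem.
      apply (Hl a); auto; [now apply (succ_set a)|]. split; auto.
    + intros a Ha s Hs Hat [_ Has]. apply (Hl a); auto.
  - pose proof def_ordinal. pose proof def_set_succ. dfn.
Qed.

Lemma limit_or_succ a : ordinal a -> limit a \/ exists b, b ∈ a /\ succ_of b a.
Proof.
  intros Ha. destruct (classic (exists b s, b ∈ a /\ succ_of b s /\ ~ s ∈ a))
    as [(b & s & Hb & Hs & Hn)|Hno].
  - right. exists b. split; auto. destruct (succ_le b a s) as [H|<-]; auto. now destruct Hn.
  - left. split; auto. intros b s Hb Hs. apply NNPP. intros Hn. apply Hno. exists b, s. auto.
Qed.

(** * Comparing cardinalities *)

Lemma card_le_intro a b R : set a -> def2 R ->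
  (forall x, x ∈ a -> exists y, y ∈ b /\ R x y) ->
  (forall x y y', x ∈ a -> R x y -> R x y' -> y = y') ->
  (forall x x' y, x ∈ a -> x' ∈ a -> R x y -> R x' y -> x = x') ->
  card_le a b.
Proof.
  intros Ha HR Htot Hfun Hinj.
  destruct (function_ex a (fun x y => y ∈ b /\ R x y)) as (f & Hf & Hfx & Hp); auto.
  { dfn. }
  { intros x y y' Hx _ _ [_ H] [_ H']. eauto. }
  exists f. split; [split; [auto|split; [|split]]|].
  - intros p Hpf. destruct (Hp p Hpf) as (x & y & Hxy).
    assert (Hin : pair_in x y f) by (exists p; auto). apply Hfx in Hin. exists x, y. tauto.
  - intros x Hx. destruct (Htot x Hx) as (y & Hy & H). exists y. apply Hfx. eauto using set_mem.
  - intros x y y' H H'. apply Hfx in H, H'. eapply Hfun; [apply H|apply H|apply H'].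
  - intros x x' y H H'. apply Hfx in H, H'.
    eapply Hinj; [apply H|apply H'|apply H|apply H'].
Qed.

Lemma card_eq_intro a b R : set a -> def2 R ->
  (forall x, x ∈ a -> exists y, y ∈ b /\ R x y) ->
  (forall x y y', x ∈ a -> R x y -> R x y' -> y = y') ->
  (forall x x' y, x ∈ a -> x' ∈ a -> R x y -> R x' y -> x = x') ->
  (forall y, y ∈ b -> exists x, x ∈ a /\ R x y) ->
  card_eq a b.
Proof.
  intros Ha HR Htot Hfun Hinj Hsurj.
  destruct (function_ex a (fun x y => y ∈ b /\ R x y)) as (f & Hf & Hfx & Hp); auto.
  { dfn. }
  { intros x y y' Hx _ _ [_ H] [_ H']. eauto. }
  exists f. split; [split; [auto|split; [|split]]|split].
  - intros p Hpf. destruct (Hp p Hpf) as (x & y & Hxy).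
    assert (Hin : pair_in x y f) by (exists p; auto). apply Hfx in Hin. exists x, y. tauto.
  - intros x Hx. destruct (Htot x Hx) as (y & Hy & H). exists y. apply Hfx. eauto using set_mem.
  - intros x y y' H H'. apply Hfx in H, H'. eapply Hfun; [apply H|apply H|apply H'].
  - intros x x' y H H'. apply Hfx in H, H'.
    eapply Hinj; [apply H|apply H'|apply H|apply H'].
  - intros y Hy. destruct (Hsurj y Hy) as (x & Hx & H). exists x. apply Hfx. eauto using set_mem.
Qed.

Lemma is_fun_in f a b x y : is_fun M mem f a b -> pair_in x y f -> x ∈ a /\ y ∈ b.
Proof.
  intros (_ & Hp & _) (p & Hxy & Hpf). destruct (Hp p Hpf) as (x' & y' & Hx & Hy & Hxy').
  destruct (opair_inj _ _ _ _ _ Hxy Hxy') as [-> ->]. auto.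
Qed.

Lemma card_le_elim a b : card_le a b -> exists f,
  (forall x y, pair_in x y f -> x ∈ a /\ y ∈ b) /\
  (forall x, x ∈ a -> exists y, pair_in x y f) /\ functional f /\ injective_class f.
Proof.
  intros (f & Hf & Hinj). exists f. split; [|split; [apply Hf|split; [apply Hf|exact Hinj]]].
  intros x y. now apply is_fun_in.
Qed.

Lemma card_eq_sym a b : set b -> card_eq a b -> card_eq b a.
Proof.
  intros Hb (f & Hf & Hinj & Hsurj). assert (Hin := fun x y => is_fun_in f a b x y Hf).
  destruct Hf as (_ & _ & Htot & Hfun).
  apply (card_eq_intro b a (fun y x => pair_in x y f)); auto; [dfn| | | |].
  - intros y Hy. destruct (Hsurj y Hy) as (x & Hx). exists x. split; auto. now apply Hin in Hx.
  - intros y x x' _. apply Hinj.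
  - intros y y' x _ _. apply Hfun.
  - intros x Hx. destruct (Htot x Hx) as (y & Hy). exists y. split; auto. now apply Hin in Hy.
Qed.

Lemma card_eq_le a b : card_eq a b -> card_le a b.
Proof. intros (f & Hf & Hinj & _). now exists f. Qed.

Lemma card_le_trans a b c : set a -> card_le a b -> card_le b c -> card_le a c.
Proof.
  intros Ha Hab Hbc. apply card_le_elim in Hab as (f & Hf & Hft & Hff & Hfi).
  apply card_le_elim in Hbc as (g & Hg & Hgt & Hgf & Hgi).
  apply (card_le_intro a c (fun x z => exists y, set y /\ (pair_in x y f /\ pair_in y z g)));
    auto; [dfn| | |].
  - intros x Hx. destruct (Hft x Hx) as (y & Hy). destruct (Hf x y Hy) as [_ Hyb].
    destruct (Hgt y Hyb) as (z & Hz). exists z. split; [now apply Hg in Hz|].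
    exists y. split; auto. eauto using set_mem.
  - intros x z z' _ (y & _ & Hy & Hz) (y' & _ & Hy' & Hz').
    rewrite <- (Hff x y y' Hy Hy') in Hz'. apply (Hgf y z z' Hz Hz').
  - intros x x' z _ _ (y & _ & Hy & Hz) (y' & _ & Hy' & Hz').
    rewrite <- (Hgi y y' z Hz Hz') in Hy'. apply (Hfi x x' y Hy Hy').
Qed.

Lemma card_le_sub a b : set a -> a ⊆ b -> card_le a b.
Proof.
  intros Ha Hab. apply (card_le_intro a b (fun x y => x = y)); auto; [dfn| | |].
  - intros x Hx. exists x. auto.
  - intros x y y' _ <- <-. auto.
  - intros x x' y _ _ -> ->. auto.
Qed.

Lemma card_le_single a s b : set s -> (forall z, z ∈ s -> z = a) -> (exists y, y ∈ b) -> card_le s b.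
Proof.
  intros Hs Hsa (y0 & Hy0). apply (card_le_intro s b (fun _ y => y = y0)); auto; [dfn| | |].
  - intros x Hx. exists y0. auto.
  - intros x y y' _ -> ->. auto.
  - intros x x' y Hx Hx' _ _. rewrite (Hsa x), (Hsa x'); auto.
Qed.

Lemma card_le_image x y F : set x -> functional F -> injective_class F ->
  (forall z, z ∈ y <-> exists z', z' ∈ x /\ pair_in z' z F) -> set y /\ card_le y x.
Proof.
  intros Hx HF Hinj Hy. assert (Hys : set y) by now apply (sm_image _ set_small_ideal x y F).
  split; auto. apply (card_le_intro y x (fun z z' => pair_in z' z F)); auto; [dfn| | |].
  - intros z Hz. now apply Hy.
  - intros z w w' _. apply Hinj.
  - intros z z' w _ _. apply HF.
Qed.

(* Transitive collapse of the image of an injection of [x] into [a]. *)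
Lemma card_le_ordinal x a : set x -> ordinal a -> card_le x a ->
  exists t, (t ∈ a \/ t = a) /\ card_eq x t.
Proof.
  intros Hx Ha Hle. apply card_le_elim in Hle as (f & Hf & Hft & Hff & Hfi).
  destruct (sep a (fun y => exists u, set u /\ pair_in u y f)) as (X & HX & HXy);
    [apply Ha|dfn|].
  assert (HXa : X ⊆ a) by (intros y Hy; now apply HXy in Hy).
  assert (HXo : forall y, y ∈ X -> ordinal y) by (intros; eapply ordinal_elem; eauto).
  (* The value at [b] is the set of the values at the earlier elements of [X]. *)
  destruct (recursion X (fun b c w z => z = w)) as (V & HVf & HVX & HVt & HVv).
  { apply (chain_sub a); auto. now apply ordinal_chain. }
  { dfn. }
  { intros b c w _ _ Hw. destruct (pair_ex w w) as (h & Hh & Hhz); auto.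
    exists h. split; auto. intros z ->. apply Hhz; auto. }
  assert (Hval : forall b v z, pair_in b v V -> (z ∈ v <-> exists c, c ∈ X /\ c ∈ b /\ pair_in c z V)).
  { intros b v z Hbv. rewrite (HVv b v Hbv z). split.
    - intros (_ & c & HcX & Hcb & w & Hw & ->). eauto.
    - intros (c & HcX & Hcb & Hz). destruct (pair_in_set _ _ _ Hz). eauto 8. }
  (* Collapsing never raises an ordinal, which bounds the image [t] by [a]. *)
  assert (Hord : forall b, set b -> b ∈ X -> forall v, set v -> pair_in b v V ->
    ordinal v /\ (v ∈ b \/ v = b)).
  { pose proof def_ordinal.
    apply (mem_induction (fun b => b ∈ X -> forall v, set v -> pair_in b v V ->
      ordinal v /\ (v ∈ b \/ v = b))); [dfn|].
    intros b Hb IH HbX v Hv Hbv.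
    assert (HIH : forall c z, c ∈ X -> c ∈ b -> pair_in c z V -> ordinal z /\ (z ∈ c \/ z = c)).
    { intros c z HcX Hcb Hz. destruct (pair_in_set _ _ _ Hz). apply IH; auto. }
    assert (Hvo : ordinal v).
    { apply ordinal_intro; auto.
      - intros z y Hz Hy. apply (Hval b v z Hbv) in Hz as (c & HcX & Hcb & Hz).
        apply (Hval c z y Hz) in Hy as (d & HdX & Hdc & Hy).
        apply (Hval b v y Hbv). exists d. split; auto. split; auto.
        apply (ordinal_trans b c); auto.
      - intros z Hz. apply (Hval b v z Hbv) in Hz as (c & HcX & Hcb & Hz).
        now apply (HIH c). }
    split; auto. apply ordinal_sub; auto. intros z Hz.
    apply (Hval b v z Hbv) in Hz as (c & HcX & Hcb & Hz).
    destruct (HIH c z) as [_ [Hzc| ->]]; auto. apply (ordinal_trans b c); auto. }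
  assert (HordV : forall b v, pair_in b v V -> ordinal v /\ (v ∈ b \/ v = b)).
  { intros b v Hbv. destruct (pair_in_set _ _ _ Hbv). apply Hord; eauto. }
  destruct (replace_ex X (fun b v => pair_in b v V)) as (t & Ht & Htz); auto.
  { dfn. }
  { intros b v v' _ _ _. apply HVf. }
  assert (Hto : ordinal t).
  { apply ordinal_intro; auto.
    - intros v z Hv Hz. apply Htz in Hv as (_ & b & HbX & Hbv).
      assert (Hzs := set_mem _ _ Hz).
      apply (Hval b v z Hbv) in Hz as (c & HcX & _ & Hcz). apply Htz. eauto.
    - intros v Hv. apply Htz in Hv as (_ & b & HbX & Hbv). now apply HordV in Hbv. }
  exists t. split.
  - apply ordinal_sub; auto. intros v Hv. apply Htz in Hv as (_ & b & HbX & Hbv).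
    destruct (HordV b v Hbv) as [_ [Hvb| ->]]; auto. apply (ordinal_trans a b); auto.
  - apply (card_eq_intro x t (fun u v => exists y, set y /\ (pair_in u y f /\ pair_in y v V)));
      auto; [dfn| | | |].
    + intros u Hu. destruct (Hft u Hu) as (y & Hy). destruct (pair_in_set _ _ _ Hy) as [Hus Hys].
      assert (HyX : y ∈ X) by (apply HXy; split; [now apply Hf in Hy|eauto]).
      destruct (HVt y HyX) as (v & Hv). destruct (pair_in_set _ _ _ Hv) as [_ Hvs].
      exists v. split; [apply Htz; eauto|]. exists y. auto.
    + intros u v v' _ (y & _ & Hy & Hv) (y' & _ & Hy' & Hv').
      rewrite <- (Hff u y y' Hy Hy') in Hv'. apply (HVf y v v' Hv Hv').
    + intros u u' v _ _ (y & _ & Hy & Hv) (y' & _ & Hy' & Hv').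
      replace y' with y in *; [apply (Hfi u u' y Hy Hy')|].
      destruct (ordinal_compare y y') as [H|[H|H]]; eauto; exfalso; apply (no_loop1 v).
      * apply (Hval y' v v Hv'). eauto.
      * apply (Hval y v v Hv). eauto.
    + intros v Hv. apply Htz in Hv as (_ & y & HyX & Hv). apply HXy in HyX as (_ & u & _ & Huy).
      exists u. split; [now apply Hf in Huy|]. exists y. split; auto.
      now destruct (pair_in_set _ _ _ Hv).
Qed.

(* Satisfied by ordinal doubling: [F a] is the union of the [F c + 2] for [c < a]. *)
Definition is_doubling (F : M) : Prop :=
  functional F /\
  (forall a, ordinal a -> exists v, pair_in a v F) /\
  (forall a v, pair_in a v F -> ordinal a /\ ordinal v) /\
  (forall a b v w s, a ∈ b -> pair_in a v F -> pair_in b w F -> succ_of v s ->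
    v ∈ w /\ s ∈ w) /\
  (forall l a v, limit l -> a ∈ l -> pair_in a v F -> v ∈ l).

Lemma doubling : exists F, is_doubling F.
Proof.
  pose proof def_ordinal as Hdo. pose proof def_limit as Hdl. pose proof def_set_succ as Hds.
  destruct (class_of ordinal Hdo) as (ON & HON).
  assert (HON' : forall a, a ∈ ON <-> ordinal a).
  { intros a. rewrite HON. split; [tauto|]. intros Ha. split; auto. apply Ha. }
  (* The relation says that [z] is an element of [w + 2]. *)
  destruct (recursion ON (fun b c w z => z ∈ w \/ z = w \/ set_succ w z))
    as (F & HFf & HFO & HFt & HFv).
  { now apply ordinals_chain. }
  { dfn. }
  { intros b c w _ _ Hw. destruct (succ_ex w Hw) as (s & Hs & Hws).
    destruct (succ_ex s Hs) as (t & Ht & Hst). exists t. split; auto.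
    intros z [Hz|[->|[_ Hz]]]; apply Hst.
    - left. apply Hws. auto.
    - left. apply Hws. auto.
    - right. now apply (succ_unique w). }
  assert (Hval : forall b v z, pair_in b v F -> (z ∈ v <-> exists c, ordinal c /\ c ∈ b /\
    exists w, pair_in c w F /\ (z ∈ w \/ z = w \/ succ_of w z))).
  { intros b v z Hbv. rewrite (HFv b v Hbv z). split.
    - intros (_ & c & Hc & Hcb & w & Hw & HH). exists c. split; [now apply HON'|]. split; auto.
      exists w. split; auto. destruct HH as [|[|[_ ?]]]; auto.
    - intros (c & Hc & Hcb & w & Hw & HH). destruct (pair_in_set _ _ _ Hw) as [_ Hws]. split.
      + destruct HH as [Hz|[->|Hz]]; eauto using set_mem, succ_set.
      + exists c. split; [now apply HON'|]. split; auto. exists w. split; auto.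
        unfold set_succ. tauto. }
  assert (Hdom : forall b v, pair_in b v F -> ordinal b).
  { intros b v Hbv. apply HON'. eauto. }
  assert (Hmon : forall a b v w s, a ∈ b -> pair_in a v F -> pair_in b w F -> succ_of v s ->
    v ∈ w /\ s ∈ w).
  { intros a b v w s Hab Hv Hw Hs. split; apply (Hval b w _ Hw); exists a; split; eauto;
      split; auto; exists v; auto. }
  assert (Hord : forall b v, pair_in b v F -> ordinal v).
  { assert (Hind : forall b, set b -> forall v, set v -> pair_in b v F -> ordinal v).
    { apply (mem_induction (fun b => forall v, set v -> pair_in b v F -> ordinal v)); [dfn|].
      intros b Hb IH v Hv Hbv.
      assert (HIH : forall c w, c ∈ b -> pair_in c w F -> ordinal w).
      { intros c w Hc Hw. destruct (pair_in_set _ _ _ Hw). eauto. }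
      apply ordinal_intro; auto.
      - intros z y Hz Hy. apply (Hval b v z Hbv) in Hz as (c & Hc & Hcb & w & Hw & HH).
        apply (Hval b v y Hbv). exists c. split; auto. split; auto. exists w. split; auto.
        destruct HH as [Hz|[->|Hz]]; auto.
        + left. apply (ordinal_trans w z); eauto.
        + apply Hz in Hy as [Hy| ->]; auto.
      - intros z Hz. apply (Hval b v z Hbv) in Hz as (c & Hc & Hcb & w & Hw & HH).
        specialize (HIH c w Hcb Hw). destruct HH as [Hz|[->|Hz]]; auto.
        + now apply (ordinal_elem w).
        + now apply (ordinal_succ w). }
    intros b v Hbv. destruct (pair_in_set _ _ _ Hbv). eauto. }
  exists F. split; auto. split; [|split; [|split; auto]].
  { intros a Ha. apply HFt. now apply HON'. }
  { intros a v Hv. eauto. }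
  (* Quantifying over all limits [l] allows the induction hypothesis to be used with [l := a] when
     [a] is a limit, giving [v] included in [a]; when [a] is the successor of [b], the value is at
     most two steps above that of [b]. *)
  assert (Hind : forall a, set a -> forall l, set l -> limit l -> a ∈ l ->
    forall v, set v -> pair_in a v F -> v ∈ l).
  { apply (mem_induction (fun a => forall l, set l -> limit l -> a ∈ l ->
      forall v, set v -> pair_in a v F -> v ∈ l)); [dfn|].
    intros a Ha IH l Hl Hlim Hal v Hv Hav. destruct Hlim as [Hlo Hls].
    assert (Hao := Hdom a v Hav). assert (Hvo := Hord a v Hav).
    assert (HIH : forall c w l, set l -> c ∈ a -> limit l -> c ∈ l -> pair_in c w F -> w ∈ l).
    { intros c w l' Hl' Hca Hlim Hcl Hw. destruct (pair_in_set _ _ _ Hw). eauto. }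
    destruct (limit_or_succ a Hao) as [Halim|(b & Hba & Hbs)].
    - assert (Hva : v ⊆ a).
      { intros z Hz. apply (Hval a v z Hav) in Hz as (c & Hc & Hca & w & Hw & HH).
        assert (Hwa : w ∈ a) by eauto.
        destruct HH as [Hz|[->|Hz]]; auto.
        - now apply (ordinal_trans a w).
        - now apply Halim with w. }
      destruct (ordinal_sub v a) as [Hva'| ->]; auto. now apply (ordinal_trans l a).
    - assert (Hbl : b ∈ l) by now apply (ordinal_trans l a).
      destruct (HFt b) as (w & Hw). { apply HON'. now apply (ordinal_elem a). }
      assert (Hwo := Hord b w Hw). assert (Hws := proj1 Hwo).
      assert (Hwl : w ∈ l) by (apply (HIH b); auto; split; auto).
      destruct (succ_ex w Hws) as (s & Hs & Hsw). destruct (succ_ex s Hs) as (t & Ht & Hts).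
      assert (Hsl : s ∈ l) by eauto. assert (Htl : t ∈ l) by eauto.
      assert (Hvt : v ⊆ t).
      { intros z Hz. apply (Hval a v z Hav) in Hz as (c & Hc & Hca & w' & Hw' & HH).
        apply Hts. apply Hbs in Hca as [Hcb| ->].
        - left. apply Hsw. left.
          destruct (succ_ex w') as (s' & _ & Hs'); [now destruct (pair_in_set _ _ _ Hw')|].
          destruct (Hmon c b w' w s' Hcb Hw' Hw Hs') as [Hww Hsw'].
          destruct HH as [Hz|[->|Hz]]; auto.
          + now apply (ordinal_trans w w').
          + now rewrite (succ_unique _ _ _ Hz Hs').
        - rewrite (HFf b w' w Hw' Hw) in HH. destruct HH as [Hz|[->|Hz]].
          + left. apply Hsw. auto.
          + left. apply Hsw. auto.
          + right. now apply (succ_unique w). }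
      destruct (ordinal_sub v t) as [Hvt'| ->]; auto.
      + now apply (ordinal_elem l).
      + now apply (ordinal_trans l t). }
  intros l a v Hlim Hal Hav. destruct (pair_in_set _ _ _ Hav).
  apply (Hind a) with (l := l); auto. apply Hlim.
Qed.

(* Elements of [x] are sent to even ordinals, the others to odd ones. *)
Lemma card_le_double F x y u b c : is_doubling F ->
  set u -> ordinal b -> card_le x b -> card_le y b ->
  (forall z, z ∈ u -> z ∈ x \/ z ∈ y) ->
  (forall a v s, a ∈ b -> pair_in a v F -> succ_of v s -> v ∈ c /\ s ∈ c) ->
  card_le u c.
Proof.
  intros (HFf & HFt & HFo & HFm & _) Hu Hb Hx Hy Huxy Hc. pose proof def_set_succ.
  apply card_le_elim in Hx as (f & Hf & Hft & Hff & Hfi).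
  apply card_le_elim in Hy as (g & Hg & Hgt & Hgf & Hgi).
  assert (HFi : injective_class F).
  { intros a a' v Ha Ha'. destruct (HFo _ _ Ha) as [Hao Hvo], (HFo _ _ Ha') as [Hao' _].
    destruct (succ_ex v (proj1 Hvo)) as (s & _ & Hs).
    destruct (ordinal_compare a a') as [Hlt|[Heq|Hlt]]; auto; exfalso; apply (no_loop1 v).
    - now apply (HFm a a' v v s).
    - now apply (HFm a' a v v s). }
  (* The successor of a double is never a double, so the codes of the two kinds of elements do not
     clash. *)
  assert (Hne : forall a a' v v', pair_in a v F -> pair_in a' v' F -> ~ succ_of v v').
  { intros a a' v v' Ha Ha' Hs. destruct (HFo _ _ Ha) as [Hao Hvo], (HFo _ _ Ha') as [Hao' Hvo'].
    destruct (succ_ex v' (proj1 Hvo')) as (s' & _ & Hs').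
    destruct (ordinal_compare a a') as [Hlt|[<-|Hlt]]; auto.
    - apply (no_loop1 v'). now apply (HFm a a' v v' v').
    - rewrite (HFf a v v' Ha Ha') in Hs. apply (no_loop1 v'). now apply Hs; right.
    - apply (no_loop2 v v'); [now apply succ_self|]. now apply (HFm a' a v' v s'). }
  apply (card_le_intro u c (fun z w => exists a, set a /\
    ((z ∈ x /\ pair_in z a f /\ pair_in a w F) \/
     (~ z ∈ x /\ pair_in z a g /\ exists v, set v /\ (pair_in a v F /\ set_succ v w)))));
    auto; [dfn| | |].
  - intros z Hz. destruct (classic (z ∈ x)) as [Hzx|Hzx].
    + destruct (Hft z Hzx) as (a & Ha). assert (Hab : a ∈ b) by now apply Hf in Ha.
      destruct (HFt a) as (v & Hv); [eapply ordinal_elem; eauto|].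
      destruct (pair_in_set _ _ _ Hv) as [_ Hvs]. destruct (succ_ex v Hvs) as (s & _ & Hs).
      exists v. split; [now apply (Hc a v s)|]. exists a. split; [eauto using set_mem|]. auto.
    + destruct (Huxy z Hz) as [|Hzy]; [contradiction|].
      destruct (Hgt z Hzy) as (a & Ha). assert (Hab : a ∈ b) by now apply Hg in Ha.
      destruct (HFt a) as (v & Hv); [eapply ordinal_elem; eauto|].
      destruct (pair_in_set _ _ _ Hv) as [_ Hvs]. destruct (succ_ex v Hvs) as (s & _ & Hs).
      exists s. split; [now apply (Hc a v s)|]. exists a. split; [eauto using set_mem|].
      right. split; auto. split; auto. exists v. split; auto. split; auto. split; auto.
  - intros z w w' _ (a & _ & [(Hz & Ha & Hw)|(Hz & Ha & v & _ & Hv & _ & Hw)])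
      (a' & _ & [(Hz' & Ha' & Hw')|(Hz' & Ha' & v' & _ & Hv' & _ & Hw')]); try contradiction.
    + rewrite <- (Hff z a a' Ha Ha') in Hw'. apply (HFf a w w' Hw Hw').
    + rewrite <- (Hgf z a a' Ha Ha') in Hv'. rewrite <- (HFf a v v' Hv Hv') in Hw'.
      now apply (succ_unique v).
  - intros z z' w _ _ (a & _ & [(Hz & Ha & Hw)|(Hz & Ha & v & _ & Hv & _ & Hw)])
      (a' & _ & [(Hz' & Ha' & Hw')|(Hz' & Ha' & v' & _ & Hv' & _ & Hw')]).
    + rewrite <- (HFi a a' w Hw Hw') in Ha'. apply (Hfi z z' a Ha Ha').
    + now destruct (Hne a' a v' w).
    + now destruct (Hne a a' v w).
    + rewrite <- (succ_inj v v' w Hw Hw') in Hv'. rewrite <- (HFi a a' v Hv Hv') in Ha'.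
      apply (Hgi z z' a Ha Ha').
Qed.

Lemma card_le_union x y u l : set u -> limit l -> card_le x l -> card_le y l ->
  (forall z, z ∈ u -> z ∈ x \/ z ∈ y) -> card_le u l.
Proof.
  intros Hu Hl Hx Hy Huxy. destruct doubling as (F & HF).
  apply (card_le_double F x y u l l); auto; [apply Hl|].
  destruct HF as (_ & _ & _ & _ & HFl).
  intros a v s Ha Hv Hs. assert (Hvl : v ∈ l) by eauto.
  split; auto. now apply Hl with v.
Qed.

(** Strict smallness needs a bound below [l] itself: the double of the common bound [b] is still
    below the limit [l], and it contains the doubles of all [a] in [b] with their successors. *)
Lemma card_le_union_below x y u l b : set u -> limit l -> b ∈ l -> card_le x b -> card_le y b ->
  (forall z, z ∈ u -> z ∈ x \/ z ∈ y) -> exists c, c ∈ l /\ card_le u c.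
Proof.
  intros Hu Hl Hb Hx Hy Huxy.
  assert (Hbo : ordinal b) by (apply (ordinal_elem l); auto; apply Hl).
  destruct doubling as (F & HF). assert (HF' := HF).
  destruct HF' as (HFf & HFt & HFo & HFm & HFl).
  destruct (HFt b Hbo) as (c & Hbc). exists c. split; [now apply (HFl l b)|].
  apply (card_le_double F x y u b c); auto.
  intros a v s Ha Hv Hs. now apply (HFm a b).
Qed.

(** * Infinite cardinals *)

(** A cardinal by definition excludes only bijections with its elements; collapsing the image of an
    injection into [d] produces such a bijection. *)
Lemma cardinal_no_inj k d : cardinal M mem k -> d ∈ k -> ~ card_le k d.
Proof.
  intros [Hk Hmin] Hd Hle.
  destruct (card_le_ordinal k d) as (t & Ht & Heq); auto; [apply Hk|now apply (ordinal_elem k d)|].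
  assert (Htk : t ∈ k) by (destruct Ht as [Ht| ->]; auto; now apply (ordinal_trans k d)).
  apply (Hmin t Htk). apply card_eq_sym; auto. eauto using set_mem.
Qed.

Local Notation natural := (natural M mem).

Lemma is_succ_intro a s : succ_of a s -> is_succ M mem s.
Proof. intros Hs. exists a. exact Hs. Qed.

Lemma natural_elem n k : natural n -> k ∈ n -> natural k.
Proof.
  intros (Hn & Hn0 & Hk) Hkn. split; [now apply (ordinal_elem n)|]. split; auto.
  intros j Hj. apply Hk. now apply (ordinal_trans n k).
Qed.

Lemma natural_succ n s : natural n -> succ_of n s -> natural s.
Proof.
  intros (Hn & Hn0 & Hk) Hs. split; [now apply (ordinal_succ n)|]. split.
  - right. now apply is_succ_intro with n.
  - intros k Hks. apply Hs in Hks as [Hkn| ->]; auto.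
Qed.

Lemma natural_empty o : set o -> (forall z, ~ z ∈ o) -> natural o.
Proof.
  intros Ho Hoz. split; [|split].
  - apply ordinal_intro; auto.
    + intros x y Hx. now apply Hoz in Hx.
    + intros x Hx. now apply Hoz in Hx.
  - left. exact Hoz.
  - intros k Hk. exfalso; now apply (Hoz k).
Qed.

Lemma def_natural : def1 natural.
Proof.
  intros t Ht. apply (definable_iff (fun e => ordinal (t e) /\
    ((forall z, set z -> ~ z ∈ t e) \/ exists m, set m /\ set_succ m (t e)) /\
    forall k, set k -> k ∈ t e ->
      (forall z, set z -> ~ z ∈ k) \/ exists m, set m /\ set_succ m k)).
  - assert (Hcase : forall k, ((forall z, set z -> ~ z ∈ k) \/ exists m, set m /\ set_succ m k) <->
      (is_empty M mem k \/ is_succ M mem k)).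
    { intros k. split.
      - intros [Hk|(m & _ & _ & Hm)]; [left|right; now exists m].
        intros z Hz. apply (Hk z); eauto using set_mem.
      - intros [Hk|(m & Hm)]; [left; auto|right]. exists m.
        assert (set m) by apply (set_mem m k), Hm, or_intror, eq_refl.
        split; auto. split; auto. }
    intros e. unfold Defs.natural. rewrite Hcase. split.
    + intros (Ho & He & Hk). split; auto. split; auto. intros k Hkt. apply Hcase.
      eauto using set_mem.
    + intros (Ho & He & Hk). split; auto. split; auto. intros k _ Hkt. apply Hcase. auto.
  - pose proof def_ordinal. pose proof def_set_succ. dfn.
Qed.

(* The bijection is the shift [m, 0, 1, 2, ... |-> 0, 1, 2, 3, ...], the identity
   on non-natural elements. *)
Lemma infinite_card_eq_succ m l : ordinal m -> ~ natural m -> succ_of m l -> card_eq m l.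
Proof.
  intros Hm Hnm Hl. pose proof def_natural. pose proof def_set_succ.
  destruct empty_ex as (o & Ho & Hoz). assert (Hon := natural_empty o Ho Hoz).
  assert (Hom : o ∈ m).
  { destruct (ordinal_compare o m) as [Hlt|[<-|Hlt]]; auto; [apply Hon| |].
    - contradiction.
    - now apply Hoz in Hlt. }
  (* Read from [m] to [l] this is the inverse shift: [o] goes to [m], and every other natural number
     to its predecessor. *)
  apply (card_eq_intro m l (fun v u => (v = o /\ u = m) \/ (natural v /\ set_succ u v) \/
    (~ natural v /\ u = v))); [apply Hm|dfn| | | |].
  - intros v Hv. destruct (classic (natural v)) as [Hnv|Hnv].
    + destruct (proj1 (proj2 Hnv)) as [Hv0|(u & Hu)].
      * exists m. split; [now apply succ_self|]. left. split; auto.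
        apply ext. intros z. split; intros Hz; exfalso; [now apply (Hv0 z)|now apply (Hoz z)].
      * assert (Huv : u ∈ v) by now apply succ_self.
        exists u. split; [apply Hl; left; now apply (ordinal_trans m v)|].
        right; left. split; auto. split; auto. eauto using set_mem.
    + exists v. split; [apply Hl; auto|]. auto.
  - assert (Hos : forall u, ~ succ_of u o).
    { intros u Hu. apply (Hoz u). now apply succ_self. }
    intros v u u' _ [[-> ->]|[[Hn [_ Hu]]|[Hn ->]]] [[Ho' ->]|[[Hn' [_ Hu']]|[Hn' ->]]];
      subst; try contradiction; auto; try (now destruct (Hos u)); try (now destruct (Hos u')).
    now apply (succ_inj u u' v).
  - intros v v' u Hv Hv' [[-> ->]|[[Hn [_ Hu]]|[Hn ->]]] [[-> Hum]|[[Hn' [_ Hu']]|[Hn' Hu']]];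
      subst; auto.
    + exfalso. apply (no_loop2 m v'); auto. now apply succ_self.
    + now destruct (no_loop1 v').
    + exfalso. apply (no_loop2 m v); auto. now apply succ_self.
    + now apply (succ_unique u).
    + exfalso. apply Hn'. apply (natural_elem v); auto. now apply succ_self.
    + now destruct (no_loop1 m).
    + exfalso. apply Hn. apply (natural_elem v'); auto. now apply succ_self.
  - intros u Hu. apply Hl in Hu as [Hu| ->]; [|exists o; auto].
    destruct (classic (natural u)) as [Hnu|Hnu]; [|exists u; auto].
    assert (Hus := set_mem _ _ Hu). destruct (succ_ex u Hus) as (v & Hv & Huv).
    assert (Hnv := natural_succ u v Hnu Huv).
    exists v. split.
    + destruct (succ_le u m v Hm Hu Huv) as [|<-]; auto. contradiction.
    + right; left. split; auto. split; auto.
Qed.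

Lemma infinite_cardinal_limit l : infinite_cardinal M mem l -> limit l.
Proof.
  intros [[Hl Hmin] Hnat]. destruct (limit_or_succ l Hl) as [|(m & Hm & Hs)]; auto.
  exfalso. apply (Hmin m Hm). apply infinite_card_eq_succ; auto.
  - now apply (ordinal_elem l).
  - intros Hn. apply Hnat. now apply (natural_succ m).
Qed.

Lemma infinite_cardinal_empty_in l o : infinite_cardinal M mem l -> set o ->
  (forall z, ~ z ∈ o) -> o ∈ l.
Proof.
  intros [[Hl _] Hnat] Ho Hoz. assert (Hon := natural_empty o Ho Hoz).
  destruct (ordinal_compare o l) as [Hlt|[<-|Hlt]]; auto; [apply Hon| |].
  - contradiction.
  - now apply Hoz in Hlt.
Qed.

(** Replaces strict inequality by a bound below [l]; two such bounds have a maximum, which can then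
    be doubled. *)
Lemma card_lt_below x l : set x -> cardinal M mem l -> card_lt x l ->
  exists b, b ∈ l /\ card_le x b.
Proof.
  intros Hx [Hl _] [Hle Hnle].
  destruct (card_le_ordinal x l Hx Hl Hle) as (t & [Ht| ->] & Heq).
  - exists t. split; auto. now apply card_eq_le.
  - destruct Hnle. apply card_eq_le, card_eq_sym; auto. apply Hl.
Qed.

Lemma card_le_ideal l : infinite_cardinal M mem l -> small_ideal (fun x => set x /\ card_le x l).
Proof.
  intros Hl. assert (Hlim := infinite_cardinal_limit l Hl). split.
  - intros x y Hxy [Hy Hle]. assert (Hx : set x) by now apply (set_sub x y). split; auto.
    apply (card_le_trans x y); auto. now apply card_le_sub.
  - intros x y u [Hx Hxl] [Hy Hyl] Hu.
    assert (Hus : set u) by now apply (sm_union _ set_small_ideal x y).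
    split; auto. apply (card_le_union x y); auto. intros z Hz. now apply Hu.
  - intros a s Ha Hs. assert (Hss : set s) by now apply (sm_single _ set_small_ideal a).
    split; auto. apply (card_le_single a); auto; [intros z Hz; now apply Hs|].
    destruct empty_ex as (o & Ho & Hoz). exists o. now apply infinite_cardinal_empty_in.
  - intros x y F [Hx Hxl] HF Hinj Hy.
    destruct (card_le_image x y F Hx HF Hinj Hy) as [Hys Hyx].
    split; auto. now apply (card_le_trans y x).
Qed.

Lemma card_lt_of_below x l c : set x -> infinite_cardinal M mem l -> c ∈ l -> card_le x c ->
  card_lt x l.
Proof.
  intros Hx [[Hl Hmin] Hnat] Hc Hle. split.
  - apply (card_le_trans x c); auto. apply card_le_sub; eauto using set_mem.
    intros z Hz. now apply (ordinal_trans l c).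
  - intros Hlx. apply (cardinal_no_inj l c); auto; [split; auto|].
    apply (card_le_trans l x); auto. apply Hl.
Qed.

Lemma card_lt_ideal l : infinite_cardinal M mem l -> small_ideal (fun x => set x /\ card_lt x l).
Proof.
  intros Hl. assert (Hlim := infinite_cardinal_limit l Hl).
  assert (Hls : set l) by apply Hlim.
  assert (Hdown : forall x y, set x -> set y -> card_le x y -> card_lt y l -> card_lt x l).
  { intros x y Hx Hy Hxy [Hyl Hly]. split; [now apply (card_le_trans x y)|].
    intros Hlx. apply Hly. now apply (card_le_trans l x). }
  split.
  - intros x y Hxy [Hy Hlt]. assert (Hx : set x) by now apply (set_sub x y). split; auto.
    apply (Hdown x y); auto. now apply card_le_sub.
  - intros x y u [Hx Hxl] [Hy Hyl] Hu.
    assert (Hus : set u) by now apply (sm_union _ set_small_ideal x y).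
    split; auto.
    destruct (card_lt_below x l Hx (proj1 Hl) Hxl) as (b & Hb & Hxb).
    destruct (card_lt_below y l Hy (proj1 Hl) Hyl) as (c & Hc & Hyc).
    assert (Hbs := set_mem _ _ Hb). assert (Hcs := set_mem _ _ Hc).
    assert (Hd : exists d, d ∈ l /\ card_le x d /\ card_le y d).
    { assert (Hbo : ordinal b) by (apply (ordinal_elem l); auto; apply Hlim).
      assert (Hco : ordinal c) by (apply (ordinal_elem l); auto; apply Hlim).
      destruct (ordinal_compare b c Hbo Hco) as [Hlt|[->|Hlt]].
      - exists c. split; auto. split; auto. apply (card_le_trans x b); auto.
        apply card_le_sub; auto. intros z Hz. now apply (ordinal_trans c b).
      - exists c. auto.
      - exists b. split; auto. split; auto. apply (card_le_trans y c); auto.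
        apply card_le_sub; auto. intros z Hz. now apply (ordinal_trans b c). }
    destruct Hd as (d & Hd & Hxd & Hyd).
    destruct (card_le_union_below x y u l d) as (e & He & Hue); auto.
    + intros z Hz. now apply Hu.
    + now apply (card_lt_of_below u l e).
  - intros a s Ha Hs. assert (Hss : set s) by now apply (sm_single _ set_small_ideal a).
    split; auto. destruct empty_ex as (o & Ho & Hoz).
    assert (Hol := infinite_cardinal_empty_in l o Hl Ho Hoz).
    destruct (succ_ex o Ho) as (i & Hi & Hoi).
    apply (card_lt_of_below s l i); auto; [now apply Hlim with o|].
    apply (card_le_single a); auto; [intros z Hz; now apply Hs|].
    exists o. now apply succ_self.
  - intros x y F [Hx Hxl] HF Hinj Hy.
    destruct (card_le_image x y F Hx HF Hinj Hy) as [Hys Hyx].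
    split; auto. now apply (Hdown y x).
Qed.

Lemma cantor a P k : set a -> (forall z, z ∈ P <-> set z /\ z ⊆ a) -> card_eq k P -> ~ card_le k a.
Proof.
  intros Ha HP (h & Hh & Hhi & Hhs) Hle.
  assert (Hhin := fun x y => is_fun_in h k P x y Hh). destruct Hh as (_ & _ & Hht & Hhf).
  apply card_le_elim in Hle as (f & Hf & Hft & Hff & Hfi).
  (* The diagonal set: [h] enumerates the subsets of [a] by [k], [f] codes the indices in [a], and
     [d] collects the codes that are not in the subset they index. *)
  destruct (sep a (fun b => exists i, set i /\ exists z, set z /\
    (pair_in i z h /\ pair_in i b f /\ ~ b ∈ z))) as (d & Hd & Hdb); auto; [dfn|].
  destruct (Hhs d) as (i & Hi). { apply HP. split; auto. intros z Hz. now apply Hdb in Hz. }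
  destruct (Hft i) as (b & Hb). { now apply Hhin in Hi. }
  destruct (pair_in_set _ _ _ Hi) as [His _].
  assert (Hno : ~ b ∈ d).
  { intros Hbd. assert (Hbd' := Hbd). apply Hdb in Hbd' as (_ & j & _ & z & _ & Hz & Hj & Hbz).
    apply Hbz. rewrite (Hfi j i b Hj Hb) in Hz. now rewrite (Hhf i z d Hz Hi). }
  apply Hno. apply Hdb. split; [now apply Hf in Hb|]. exists i. split; auto. exists d. auto.
Qed.

(** * The two kinds of structures *)

(** Classes enter the game as predicates on the objects of the model; only those that are extensions
    of subclasses of [U] count. *)
Definition sub_of (U : M) (P : M -> Prop) : Prop :=
  exists c, c ⊆ U /\ forall x, x ∈ c <-> P x.

Definition small_sub_of (U : M) (Small : M -> Prop) (P : M -> Prop) : Prop :=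
  exists c, c ⊆ U /\ Small c /\ forall x, x ∈ c <-> P x.

Lemma ideal_algebra_of U Small : small_ideal Small -> ~ Small U ->
  (exists s, Small s) ->
  (forall c, c ⊆ U -> ~ Small c -> splits Small c) ->
  ideal_algebra (sub_of U) (small_sub_of U Small).
Proof.
  intros HS HU (s0 & Hs0) Hsplit. split.
  - intros P Q HPQ (c & Hc & Hx). exists c. split; auto. intros x. now rewrite Hx.
  - intros P Q (c & Hc & Hcx) (d & Hd & Hdx).
    destruct (class_of (fun x => x ∈ c /\ ~ x ∈ d)) as (b & Hb); [dfn|].
    exists b. split; [intros x Hx; apply Hc; now apply Hb in Hx|].
    intros x. rewrite Hb, Hcx, Hdx. unfold minus. split; [tauto|]. intros H. split; auto.
    apply (set_mem x c). now apply Hcx.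
  - intros P Q (c & Hc & Hcx) (d & Hd & Hdx).
    destruct (class_of (fun x => x ∈ c \/ x ∈ d)) as (b & Hb); [dfn|].
    exists b. split; [intros x Hx; apply Hb in Hx as [_ [Hx|Hx]]; auto|].
    intros x. rewrite Hb, <- Hcx, <- Hdx. split; [tauto|]. intros H. split; auto.
    destruct H; eauto using set_mem.
  - intros P (c & Hc & _ & Hx). exists c. auto.
  - intros P Q (c & Hc & Hcx) HPQ (d & Hd & Hsd & Hdx). exists c. split; auto. split; auto.
    apply (sm_sub _ HS c d); auto. intros x Hx. now apply Hdx, HPQ, Hcx.
  - intros P Q (c & Hc & Hsc & Hcx) (d & Hd & Hsd & Hdx).
    destruct (class_of (fun x => x ∈ c \/ x ∈ d)) as (b & Hb); [dfn|].
    assert (Hb' : forall x, x ∈ b <-> x ∈ c \/ x ∈ d).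
    { intros x. rewrite Hb. split; [tauto|]. intros H. split; auto. destruct H; eauto using set_mem. }
    exists b. split; [intros x Hx; apply Hb' in Hx as [Hx|Hx]; auto|].
    split; [now apply (sm_union _ HS c d)|]. intros x. now rewrite Hb', Hcx, Hdx.
  - destruct empty_ex as (o & Ho & Hoz). exists o.
    split; [intros z Hz; now apply Hoz in Hz|]. split.
    + apply (sm_sub _ HS o s0); auto. intros z Hz; now apply Hoz in Hz.
    + intros x. split; [apply Hoz|tauto].
  - intros P x (c & Hc & Hcx) Hx. apply Hcx in Hx.
    assert (Hxs := set_mem _ _ Hx). destruct (pair_ex x x) as (p & Hp & Hpz); auto.
    exists p. split; [intros z Hz; apply Hpz in Hz as [-> | ->]; auto|]. split.
    + apply (sm_single _ HS x); auto. intros z. rewrite Hpz. tauto.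
    + intros z. rewrite Hpz. split; [intros [-> | ->]; auto|auto].
  - exists (fun x => x ∈ U). split; [exists U; split; [now intros z|tauto]|]. split.
    + intros (c & _ & Hsc & Hx). apply HU. apply (sm_sub _ HS U c); auto. intros z. apply Hx.
    + intros P (c & Hc & Hx) x HPx. now apply Hc, Hx.
  - intros P (c & Hc & Hcx) HnP.
    assert (Hnc : ~ Small c) by (intros Hsc; apply HnP; exists c; auto).
    destruct (Hsplit c Hc Hnc) as (b & Hbc & Hnb & Hrest).
    exists (fun x => x ∈ b). split; [exists b; split; [|tauto]; intros z Hz; auto|].
    split; [intros x Hx; now apply Hcx, Hbc|]. split.
    + intros (b' & _ & Hsb & Hx). apply Hnb. apply (sm_sub _ HS b b'); auto. intros z. apply Hx.
    + intros (d & _ & Hsd & Hdx). apply (Hrest d); auto. intros z. rewrite Hdx, Hcx. reflexivity.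
Qed.

Lemma PK_represents k Sp Small : ordinal k -> small_ideal Small -> ~ Small k ->
  (exists s, Small s) ->
  (forall a : PK M mem k, Sp a <-> Small (proj1_sig a)) ->
  represents (PK_sub M mem k) Sp (fun (a : PK M mem k) x => x ∈ proj1_sig a)
    (sub_of k) (small_sub_of k Small).
Proof.
  intros Hk HS Hnk Hne HSp. split.
  - apply ideal_algebra_of; auto. intros c Hc. apply chain_splits; auto.
    apply (chain_sub k); auto. now apply ordinal_chain.
  - intros (a & Has & Hak). exists a. split; auto. simpl. tauto.
  - intros P (c & Hc & Hx). assert (Hcs : set c) by (apply (set_sub c k); auto; apply Hk).
    now exists (exist _ c (conj Hcs Hc)).
  - intros a b. reflexivity.
  - intros (a & Ha) (b & Hb) Hab. simpl in Hab. assert (a = b) by now apply ext. subst b.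
    f_equal. apply proof_irrelevance.
  - intros (a & Has & Hak). rewrite HSp. simpl. split.
    + intros Hsa. exists a. split; auto. split; auto. tauto.
    + intros (c & _ & Hsc & Hx). apply (sm_sub _ HS a c); auto. intros z. apply Hx.
Qed.

Lemma classes_represents V : (forall x, x ∈ V <-> set x) ->
  represents (subclass M mem) set (fun a x => x ∈ a) (sub_of V) (small_sub_of V set).
Proof.
  intros HV. assert (HaV : forall a, a ⊆ V) by (intros a z Hz; apply HV; eauto using set_mem).
  split.
  - apply ideal_algebra_of.
    + apply set_small_ideal.
    + intros Hs. apply (no_loop1 V). now apply HV.
    + destruct empty_ex as (o & Ho & _). now exists o.
    + intros c _. apply proper_splits.
  - intros a. exists a. split; [apply HaV|tauto].
  - intros P (c & _ & Hx). exists c. exact Hx.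
  - intros a b. reflexivity.
  - apply ext.
  - intros a. split.
    + intros Ha. exists a. split; [apply HaV|]. split; auto. tauto.
    + intros (c & _ & Hc & Hx). apply (set_sub a c); auto. intros z. apply Hx.
Qed.

Lemma universe_ex : exists V, forall x, x ∈ V <-> set x.
Proof.
  destruct (class_of (fun x => x = x)) as (V & HV); [dfn|].
  exists V. intros x. rewrite HV. tauto.
Qed.

End SetTheory.

Theorem theorem3p1 (M : Type) (mem : M -> M -> Prop) (HM : GBC M mem) :
  (forall kappa lambda : M,
      infinite_cardinal M mem lambda -> infinite_cardinal M mem kappa ->
      subclass M mem lambda kappa ->
      elem_equiv (PK_sub M mem kappa) (small_lt M mem kappa lambda)
                 (subclass M mem) (isSet M mem)) /\
  (forall lambda mu : M,
      infinite_cardinal M mem lambda -> is_two_pow M mem lambda mu ->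
      elem_equiv (PK_sub M mem mu) (small_le M mem mu lambda)
                 (subclass M mem) (isSet M mem)).
Proof.
  destruct (universe_ex HM) as (V & HV). split.
  - intros kappa lambda Hl [[Hk _] _] Hlk.
    assert (Hls : isSet M mem lambda) by apply Hl.
    eapply represents_elem_equiv; [|apply (classes_represents HM V HV)].
    apply (PK_represents HM kappa _ (fun x => isSet M mem x /\ card_lt M mem x lambda)); auto.
    + now apply card_lt_ideal.
    (* The inclusion of [lambda] in [kappa] is an injection, so [kappa] is not small. *)
    + intros [_ [_ Hn]]. apply Hn. now apply card_le_sub.
    + destruct (empty_ex HM) as (o & Ho & Hoz). exists o. split; auto.
      apply (card_lt_of_below HM o lambda o); auto.
      * now apply infinite_cardinal_empty_in.
      * now apply card_le_sub.
    + intros (a & Ha & Hak). unfold small_lt. simpl. tauto.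
  - intros lambda mu Hl ([Hmu _] & P & _ & HP & Heq).
    assert (Hls : isSet M mem lambda) by apply Hl.
    eapply represents_elem_equiv; [|apply (classes_represents HM V HV)].
    apply (PK_represents HM mu _ (fun x => isSet M mem x /\ card_le M mem x lambda)); auto.
    + now apply card_le_ideal.
    (* By Cantor's theorem the top element [mu] lies outside the ideal. *)
    + intros [_ Hle]. now apply (cantor HM lambda P mu).
    + exists lambda. split; auto. apply card_le_sub; auto. now intros z.
    + intros (a & Ha & Hak). unfold small_le. simpl. tauto.
Qed.
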